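(* Let $F$, the partitions $\{A_j^m\}_{j=0}^m$ of $Y$ and $\{B_i^m\}_{i=1}^{N(m)}$ of $X$, the sequences $h_m,\delta_m,\sigma_m,R_m>0$, the constant $\sigma_0>0$ and the model $p(y|x,\mathcal{M}_3)$ be as described in the context. Suppose: (a) $h_m\to0$, and for every $y\in Y$ there exists $M_0$ such that $C_{\delta_m}(y)\cap A_0^m=\varnothing$ for all $m\ge M_0$; (b) $\delta_m\to 0$, $\sigma_m/\delta_m\to 0$, $\delta_m^{d-1}h_m/\sigma_m^d\to 0$; (c) $X=[0,1]^{d_x}$ and $f(y|x)$ is continuous in $(y,x)$ a.s. $F$; (d) the second moments of $y$ under $F$ are finite; (e) there is $r>0$ such that for any $(y,x)$ there exists a hypercube $C(r,y,x)$ with side length $r$ and $y\in C(r,y,x)$ such that (i) $$\int \log\frac{f(y|x)}{\inf_{z\in C(r,y,x),\,\|t-x\|\le r}f(z|t)}\,F(dy,dx)<\infty$$ and (ii) there exists $M$ such that for any $m\ge M$: if $y\in A_0^m$, then $C(r,y,x)\cap A_0^m$ contains a hypercube $C_0(r,y,x)$ with side length $r/2$ and a vertex at $y$; and if $y\in Y\setminus A_0^m$, then $C(r,y,x)\cap(Y\setminus A_0^m)$ contains a hypercube $C_1(r,y,x)$ with side length $r/2$ and a vertex at $y$; (f) $1>2^{-(d+1)}>\phi(y,0,\sigma_0)\,\lambda(C_0(r,y,x))$; (g) $R_m\to\infty$ and $$\exp\{-R_ms_m\}/s_m^{d_x/2}\to0,\qquad\text{where } s_m=d_x\,\lambda(B_i^m)^{2/d_x}\to0.$$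 Then $d_{\mathrm{KL}}(F,\mathcal{M}_3)\to0$ as $m\to\infty$.
   Context: $F$ is a probability distribution on $Y\times X$, $Y\subset\mathbb{R}^d$, $X=[0,1]^{d_x}$. The conditional distribution of $y$ given $x$ has a density $f(y|x)$ with respect to Lebesgue measure $\lambda$; the marginal of $x$ has a density $f(x)$ with respect to some generic measure. $F(A|x)=\int_A f(y|x)\,dy$. $\phi(y,\mu,\sigma)$ is the density at $y\in\mathbb{R}^d$ of the normal distribution with mean $\mu$ and covariance matrix $\sigma^2 I$. For a model $\mathcal{M}$ with conditional density $p(y|x,\mathcal{M})$, $$d_{\mathrm{KL}}(F,\mathcal{M})=\int\log\frac{f(y|x)}{p(y|x,\mathcal{M})}\,F(dy,dx).$$ Hypercubes have edges parallel to the coordinate axes. $C_\delta(y)$ is the hypercube with center $y$ and side length $\delta$. For each $m$, $A_0^m,A_1^m,\dots,A_m^m$ is a partition of $Y$, where $A_1^m,\dots,A_m^m$ are adjacent half-open half-closed hypercubes with side length $h_m$ (cells of a regular cubic grid) and $A_0^m$ is the rest of $Y$. $\mu_j^m$ is the center of $A_j^m$, $j\ge1$; $\sigma_0$ is fixed (independent of $m$). $B_i^m$, $i=1,\dots,N(m)$, are equal size half-open half-closed hypercubes forming a partition of $X=[0,1]^{d_x}$, with $\lambda(B_i^m)=N(m)^{-1}\to0$ as $m\to\infty$ ($\lambda$ here is Lebesgue measure on $\mathbb{R}^{d_x}$); $x_i^m$ is the center of $B_i^m$; $s_m$ is the squared diagonal of $B_i^m$. In infima over $\|t-x\|\le r$,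 $t$ ranges over $X$. The model (logit mixing probabilities with indices linear in $x$) is $$p(y|x,\mathcal{M}_3)=\sum_{i=1}^{N(m)}\Big[\sum_{j=1}^m\alpha_{ij}^m(x)\phi(y,\mu_j^m,\sigma_m)+\alpha_{i0}^m(x)\phi(y,0,\sigma_0)\Big],$$ $$\alpha_{ij}^m(x)=F(A_j^m|x_i^m)\,\frac{\exp\{-R_m(x_i^{m\prime}x_i^m-2x_i^{m\prime}x)\}}{\sum_{l=1}^{N(m)}\exp\{-R_m(x_l^{m\prime}x_l^m-2x_l^{m\prime}x)\}},\quad j=0,1,\dots,m,$$ equivalently $\alpha_{ij}^m(x)\propto\exp\{\log F(A_j^m|x_i^m)-R_m(x_i^{m\prime}x_i^m-2x_i^{m\prime}x)\}$ normalized over all $(i,j)$. *)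

(* Defs.v *)
From HB Require Import structures.
From mathcomp Require Import all_boot all_order all_algebra.
From mathcomp Require Import all_classical all_reals all_analysis.

Set Implicit Arguments.
Unset Strict Implicit.
Unset Printing Implicit Defensive.

Import Order.TTheory GRing.Theory Num.Theory.
Import numFieldNormedType.Exports.

Local Open Scope classical_set_scope.
Local Open Scope ring_scope.

(* R^n is 'rV[R]_n with its library (product) topology.  The library has no
   sigma-algebra on row vectors: the one declared here is generated by the
   coordinate maps, i.e. it is the Borel sigma-algebra of R^n. *)
Section rV_measurable.
Variables (R : realType) (n : nat).

Definition rV_coord (i : 'I_n) (v : 'rV[R]_n) : measurableTypeR R := v ord0 i.

Definition rV_measurable : set (set 'rV[R]_n) := g_sigma_preimage rV_coord.

Let rV_set0 : rV_measurable set0.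
Proof. exact: sigma_algebra0. Qed.

Let rV_setC A : rV_measurable A -> rV_measurable (~` A).
Proof. exact: sigma_algebraC. Qed.

Let rV_bigcup (F : (set 'rV[R]_n)^nat) : (forall i, rV_measurable (F i)) ->
  rV_measurable (\bigcup_i (F i)).
Proof. exact: sigma_algebra_bigcup. Qed.

HB.instance Definition _ := @isMeasurable.Build default_measure_display
  'rV[R]_n rV_measurable rV_set0 rV_setC rV_bigcup.

Lemma measurable_rV_coord (i : 'I_n) : measurable_fun [set: 'rV[R]_n] (rV_coord i).
Proof.
move=> _ Y mY; rewrite setTI; apply: sub_sigma_algebra => /=.
rewrite -bigcup_seq/=; exists i => /=; first by rewrite mem_index_enum.
by exists Y => //; rewrite setTI.
Qed.

Lemma measurable_fun_rVP d (T : measurableType d) (f : T -> 'rV[R]_n) :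
  (forall i, measurable_fun [set: T] (rV_coord i \o f)) ->
  measurable_fun [set: T] f.
Proof.
move=> mf _ A mA; rewrite setTI; move: A mA.
have /smallest_sub H : sigma_algebra setT [set A | measurable (f @^-1` A)].
  split => /=.
  - by rewrite preimage_set0.
  - by move=> A mA; rewrite setTD preimage_setC; exact: measurableC.
  - by move=> F mF; rewrite preimage_bigcup; exact: bigcup_measurable.
apply: H => A; rewrite -bigcup_seq => -[i _ [B mB <-]] /=.
by have := mf i measurableT B mB; rewrite !setTI.
Qed.

End rV_measurable.

(* Lebesgue measure on R^n, by recursion on n: on R^(n+1) it is the image of
   the product measure on R x R^n, and on the singleton R^0 it is the unit
   mass.  Its value on boxes is lebesgue_rV_box. *)
Section lebesgue_rV.
Variable R : realType.

Definition rV_cons n (p : measurableTypeR R * 'rV[R]_n) : 'rV[R]_n.+1 :=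
  \row_i (if unlift ord0 i is Some j then p.2 ord0 j else p.1).

Lemma rV_cons0 n (p : measurableTypeR R * 'rV[R]_n) :
  rV_cons p ord0 ord0 = p.1.
Proof. by rewrite mxE unlift_none. Qed.

Lemma rV_consS n (p : measurableTypeR R * 'rV[R]_n) j :
  rV_cons p ord0 (lift ord0 j) = p.2 ord0 j.
Proof. by rewrite mxE liftK. Qed.

Lemma measurable_rV_cons n : measurable_fun setT (@rV_cons n).
Proof.
apply: measurable_fun_rVP => i; case: (unliftP ord0 i) => [j|] ->.
- rewrite (_ : _ \o _ = rV_coord j \o snd); last first.
    by apply/funext => p /=; rewrite /rV_coord rV_consS.
  apply: measurableT_comp; [exact: measurable_rV_coord | exact: measurable_snd].
- rewrite (_ : _ \o _ = fst); first exact: measurable_fst.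
  by apply/funext => p /=; rewrite /rV_coord rV_cons0.
Qed.

Definition rV_uncons n (v : 'rV[R]_n.+1) : measurableTypeR R * 'rV[R]_n :=
  (v ord0 ord0, \row_j v ord0 (lift ord0 j)).

Lemma rV_consK n : cancel (@rV_cons n) (@rV_uncons n).
Proof.
move=> [t v]; rewrite /rV_uncons rV_cons0; congr pair.
by apply/rowP => j; rewrite mxE rV_consS.
Qed.

Lemma measurable_rV_uncons n : measurable_fun setT (@rV_uncons n).
Proof.
apply/measurable_fun_pair; first exact: (@measurable_rV_coord R n.+1 ord0).
apply: measurable_fun_rVP => i.
rewrite (_ : _ \o _ = rV_coord (lift ord0 i)); last first.
  by apply/funext => v; rewrite /rV_coord /= mxE.
exact: measurable_rV_coord.
Qed.

Section step.
Variables (n : nat) (mu : {sigma_finite_measure set 'rV[R]_n -> \bar R}).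

Definition lebesgue_rV_step : set 'rV[R]_n.+1 -> \bar R :=
  pushforward (lebesgue_measure \x mu)%E (@rV_cons n).

Let image_measure : {measure set 'rV[R]_n.+1 -> \bar R} :=
  measure_function_pushforward__canonical__measure_function_Measure
    (lebesgue_measure \x mu)%E (@measurable_rV_cons n).

Let step0 : lebesgue_rV_step set0 = 0%E.
Proof. exact: (@measure0 _ _ _ image_measure). Qed.

Let step_ge0 A : (0 <= lebesgue_rV_step A)%E.
Proof. exact: (@measure_ge0 _ _ _ image_measure). Qed.

Let step_sigma_additive : semi_sigma_additive lebesgue_rV_step.
Proof. exact: (@measure_semi_sigma_additive _ _ _ image_measure). Qed.

HB.instance Definition _ := isMeasure.Build _ _ _ lebesgue_rV_step
  step0 step_ge0 step_sigma_additive.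

Let step_sigma_finite : sigma_finite setT lebesgue_rV_step.
Proof.
have [F TF Foo] : sigma_finite setT (lebesgue_measure \x mu)%E.
  have /sigma_finiteP[G [TG ndG Goo]] := sigma_finiteT (@lebesgue_measure R).
  have /sigma_finiteP[H [TH ndH Hoo]] := sigma_finiteT mu.
  exists (fun k => G k `*` H k).
    rewrite -setXTT TG TH predeqE => -[x y]; split.
      move=> [/= [k _ Gx] [l _ Hy]]; exists (maxn k l) => //; split.
      - by move: x Gx; exact/subsetPset/ndG/leq_maxl.
      - by move: y Hy; exact/subsetPset/ndH/leq_maxr.
    by move=> [k _ []/= ? ?]; split; exists k.
  move=> k; have [? ?] := Goo k; have [? ?] := Hoo k.
  split; first exact: measurableX.
  by rewrite product_measure1E// lte_mul_pinfty// ge0_fin_numE.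
exists (fun i => @rV_uncons n @^-1` F i).
  by rewrite -preimage_bigcup -TF preimage_setT.
move=> i; have [mF Fi] := Foo i; split.
  by rewrite -[X in measurable X]setTI; exact: measurable_rV_uncons.
by rewrite /lebesgue_rV_step /pushforward -comp_preimage
  (_ : _ \o _ = id) ?preimage_id//; exact/funext/rV_consK.
Qed.

HB.instance Definition _ := @Measure_isSigmaFinite.Build _ _ _
  lebesgue_rV_step step_sigma_finite.

End step.

Fixpoint lebesgue_rV n : {sigma_finite_measure set 'rV[R]_n -> \bar R} :=
  if n is n'.+1 then lebesgue_rV_step (lebesgue_rV n') else \d_ (0 : 'rV[R]_0).

Lemma lebesgue_rV_box n (I : 'I_n -> set (measurableTypeR R)) :
  (forall i, measurable (I i)) ->
  lebesgue_rV n [set v | forall i, I i (v ord0 i)] =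
  (\prod_(i < n) lebesgue_measure (I i))%E.
Proof.
elim: n I => [|n IHn] I mI /=.
  rewrite big_ord0 diracE mem_set//=; by case.
transitivity ((lebesgue_measure \x lebesgue_rV n)%E
    (@rV_cons n @^-1` [set v | forall i, I i (v ord0 i)])) => //.
rewrite (_ : _ @^-1` _ =
    I ord0 `*` [set v : 'rV_n | forall i, I (lift ord0 i) (v ord0 i)]); last first.
  apply/seteqP; split => -[t v] /=.
    move=> H; split; first by have := H ord0; rewrite rV_cons0.
    by move=> i; have := H (lift ord0 i); rewrite rV_consS.
  move=> [I0 IS] i; case: (unliftP ord0 i) => [j|] ->; first by rewrite rV_consS.
  by rewrite rV_cons0.
rewrite product_measure1E//.
  by rewrite big_ord_recl; congr (_ * _)%E; exact: (IHn (fun i => I (lift ord0 i))).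
rewrite (_ : [set _ | _] =
    \bigcap_(i in [set: 'I_n]) rV_coord i @^-1` I (lift ord0 i)); last first.
  by apply/seteqP; split => v /= H i; [move=> _|]; exact: H.
apply: fin_bigcap_measurable => // i _.
by rewrite -[X in measurable X]setTI; exact: measurable_rV_coord.
Qed.

End lebesgue_rV.

Section geometry.
Variables (R : realType) (n : nat).
Implicit Types (u v c : 'rV[R]_n) (s : R) (A : set 'rV[R]_n).

Definition dotv u v : R := \sum_(i < n) u ord0 i * v ord0 i.

(* The library norm on 'rV[R]_n is the sup norm; this is the Euclidean one. *)
Definition enorm u : R := Num.sqrt (dotv u u).

Definition unit_cube : set 'rV[R]_n :=
  [set x | forall i, 0 <= x ord0 i <= 1].

Definition cube c s : set 'rV[R]_n :=
  [set z | forall i, `|z ord0 i - c ord0 i| <= s / 2].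

Definition is_hypercube s A := exists c, A = cube c s.

Definition is_hypercube_with_vertex s v A :=
  exists c, A = cube c s /\ forall i, `|v ord0 i - c ord0 i| = s / 2.

Definition cell c s : set 'rV[R]_n :=
  [set z | forall i, c ord0 i - s / 2 <= z ord0 i < c ord0 i + s / 2].

(* The closed cube [0,1]^n is not a disjoint union of half-open cubes, so a
   cell of [0,1]^n that touches a face {x_i = 1} also contains its points on
   that face. *)
Definition unit_cube_cell c s : set 'rV[R]_n :=
  [set x | forall i, c ord0 i - s / 2 <= x ord0 i /\
    (x ord0 i < c ord0 i + s / 2 \/ x ord0 i = 1 /\ c ord0 i + s / 2 = 1)].

(* A0 and the A j partition Y, the A j being cells of side h, with centers
   mu j, of one common cubic grid (o is the center of a reference cell). *)
Definition cubic_grid_partition (Y : set 'rV[R]_n) (h : R) (m : nat)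
    (A0 : set 'rV[R]_n) (A : 'I_m -> set 'rV[R]_n) (mu : 'I_m -> 'rV[R]_n) :=
  [/\ forall j, A j = cell (mu j) h,
      exists o : 'rV[R]_n, forall j, exists k : 'I_n -> int,
        forall i, mu j ord0 i = o ord0 i + h * (k i)%:~R,
      A0 `|` \bigcup_j A j = Y,
      trivIset [set: 'I_m] A &
      forall j, A0 `&` A j = set0].

Definition unit_cube_partition (b : R) (N : nat)
    (B : 'I_N -> set 'rV[R]_n) (xc : 'I_N -> 'rV[R]_n) :=
  [/\ forall i, B i = unit_cube_cell (xc i) b,
      \bigcup_i B i = unit_cube &
      trivIset [set: 'I_N] B].

(* Density at y of the normal distribution with mean mu and covariance matrix
   s^2 I. *)
Definition normal_density (y mu : 'rV[R]_n) (s : R) : R :=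
  (2 * pi * s ^+ 2) `^ (- (n%:R / 2)) *
  expR (- (dotv (y - mu) (y - mu) / (2 * s ^+ 2))).

End geometry.
Arguments unit_cube {R} n.

Section densities.
Variables (R : realType) (d dx : nat).
Implicit Types (F : probability ('rV[R]_d * 'rV[R]_dx)%type R)
  (Y : set 'rV[R]_d) (X : set 'rV[R]_dx) (f p : 'rV[R]_d -> 'rV[R]_dx -> R).

(* F is a distribution on Y x X; f is its conditional density of y given x
   with respect to Lebesgue measure, g its marginal density of x with respect
   to nu.  Only the values of f on Y x X and of g on X are relevant. *)
Definition has_densities F Y X f (nu : {measure set 'rV[R]_dx -> \bar R})
    (g : 'rV[R]_dx -> R) :=
  F (Y `*` X) = 1%E /\
  [/\ forall y x, Y y -> X x -> 0 <= f y x,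
      measurable_fun (Y `*` X) (fun z => f z.1 z.2) &
      forall x, X x -> (\int[lebesgue_rV R d]_(y in Y) (f y x)%:E)%E = 1%E] /\
  [/\ forall x, X x -> 0 <= g x,
      measurable_fun X g &
      forall A B, measurable A -> measurable B -> A `<=` Y -> B `<=` X ->
        F (A `*` B) = (\int[nu]_(x in B)
          ((\int[lebesgue_rV R d]_(y in A) (f y x)%:E) * (g x)%:E))%E].

(* F(A|x), for A included in Y *)
Definition cond_prob f (A : set 'rV[R]_d) (x : 'rV[R]_dx) : R :=
  \int[lebesgue_rV R d]_(y in A) f y x.

(* inf of f(z|t) over z in D, with t in X and |t - x| <= r *)
Definition local_inf f X (r : R) (D : set 'rV[R]_d) (x : 'rV[R]_dx) : \bar R :=
  ereal_inf [set (f w.1 w.2)%:E |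
    w in D `*` [set t | X t /\ enorm (t - x) <= r]].

(* In the extended reals a / 0 = +oo for a > 0, lne +oo = +oo, lne 0 = -oo. *)
Definition d_KL F Y X f p : \bar R :=
  (\int[F]_(z in Y `*` X) lne ((f z.1 z.2)%:E / (p z.1 z.2)%:E))%E.

Definition logit_weight (Rm : R) (N : nat) (xc : 'I_N -> 'rV[R]_dx)
    (i : 'I_N) (x : 'rV[R]_dx) : R :=
  expR (- (Rm * (dotv (xc i) (xc i) - 2 * dotv (xc i) x))) /
  \sum_(l < N) expR (- (Rm * (dotv (xc l) (xc l) - 2 * dotv (xc l) x))).

(* alpha_ij(x) for S = A_j, j = 0, ..., m *)
Definition mixing_prob f (Rm : R) (N : nat) (xc : 'I_N -> 'rV[R]_dx)
    (S : set 'rV[R]_d) (i : 'I_N) (x : 'rV[R]_dx) : R :=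
  cond_prob f S (xc i) * logit_weight Rm xc i x.

Definition model3 f (Rm sigma sigma0 : R)
    (m : nat) (A0 : set 'rV[R]_d) (A : 'I_m -> set 'rV[R]_d)
    (mu : 'I_m -> 'rV[R]_d) (N : nat) (xc : 'I_N -> 'rV[R]_dx)
    (y : 'rV[R]_d) (x : 'rV[R]_dx) : R :=
  \sum_(i < N)
    (\sum_(j < m) mixing_prob f Rm xc (A j) i x * normal_density y (mu j) sigma
     + mixing_prob f Rm xc A0 i x * normal_density y 0 sigma0).

End densities.

(* Main.v *)
Require Import Defs.
From HB Require Import structures.
From mathcomp Require Import all_boot all_order all_algebra.
From mathcomp Require Import all_classical all_reals all_analysis.
From mathcomp Require Import measurable_realfun ring lra.

Set Implicit Arguments.
Unset Strict Implicit.
Unset Printing Implicit Defensive.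

Import Order.TTheory GRing.Theory Num.Theory.
Import numFieldNormedType.Exports.

Local Open Scope classical_set_scope.
Local Open Scope ring_scope.

(** Write p_m for the model and L_m = log (f / p_m).  The divergence is the
    F-integral of L_m, and it tends to 0 for two reasons.

    Its negative part costs nothing.  Since p_m(.|x) is a mixture of densities,
    1 - log u <= 1 / u applied to u = f / p_m gives, after integration against
    F = f d(Lebesgue x rho), with rho the marginal law of x, that the integral
    of the negative part of L_m is at most that of the positive part
    (integral_neg_log_ratio, conditional_density_joint, integral_model3_le).
    So it suffices that the positive part of L_m tends to 0 in mean, and this
    only requires lower bounds on p_m, obtained by restricting the double sum
    that defines p_m to well chosen indices.

    In x, restrict to the cells whose center is at squared distance at most
    2 s_m of x.  The center of the cell of x is at squared distance at most
    s_m / 4, so the logit weights of the other cells add up to at most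
    N(m) exp (- R_m s_m), that is, to a constant times
    exp (- R_m s_m) / s_m^(d_x / 2), which vanishes
    (sum_near_logit_weight_ge).

    In y, on a set D covered by the cells A_j the sum of
    F(A_j|t) phi(y, mu_j, sigma) dominates the integral over D of l psi as soon
    as l <= f(.|t) on D and psi <= phi(y, mu_j, sigma) on D and A_j
    (grid_mixture_ge_cells).  Two choices of D are used.

    - Pointwise convergence: D is the cube of half-side K sigma_m around y.  A
      point of D is within h_m / 2 of the center of its cell, coordinatewise,
      so psi may be taken to be the normal density centered at y up to a factor
      that tends to 1 because h_m / sigma_m does; its mass on D is close to 1
      when K is large (model3_ge_cube).  By continuity l may be taken close to
      f(y|x), so that liminf p_m >= f at almost every point; the points y left
      out lie on the faces of cells, because elsewhere y is interior to Y.

    - Domination: if y is in a cell, D is a cube of side sigma_m with a vertex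
      at y, on which phi(y, mu_j, sigma_m) is at least a constant times
      sigma_m^(-d).  If y is in A_0, the normal density with the fixed scale
      sigma_0 takes over and D is C_0.  Either way
      p_m >= (inf f) exp (- K_0 - |y|^2 / (2 sigma_0^2))
      (model3_ge_local_inf), so the positive part of L_m is at most
      log (f / inf f) plus an integrable function of y.

    The envelope log (f / inf f) may fail to be measurable, the cubes C(r,y,x)
    being arbitrary, and its integral is then a lower integral.  Dominated
    convergence survives: the supremum over m of the dominated functions is
    measurable and lies below the envelope, so its integral is finite
    (cvg_integral_lower_dominated). *)

(** * Euclidean geometry and Lebesgue measure on row vectors *)

Section row_vectors.
Variables (R : realType) (n : nat).
Implicit Types (u v c y z : 'rV[R]_n) (s : R).

Definition sqdist u v : R := \sum_(i < n) (u ord0 i - v ord0 i) ^+ 2.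

Lemma dotvBE u v : dotv (u - v) (u - v) = sqdist u v.
Proof. by apply: eq_bigr => i _; rewrite !mxE expr2. Qed.

Lemma sqdistC u v : sqdist u v = sqdist v u.
Proof. by apply: eq_bigr => i _; rewrite -sqrrN opprB. Qed.

Lemma sqdist_ge0 u v : 0 <= sqdist u v.
Proof. by apply: sumr_ge0 => i _; exact: sqr_ge0. Qed.

Lemma sqr_coord_le_sqdist u v i : (u ord0 i - v ord0 i) ^+ 2 <= sqdist u v.
Proof.
rewrite /sqdist (bigD1 i)//= lerDl; apply: sumr_ge0 => j _; exact: sqr_ge0.
Qed.

Lemma measurable_row_coord (i : 'I_n) :
  measurable_fun setT (fun v : 'rV[R]_n => v ord0 i : measurableTypeR R).
Proof. exact: measurable_rV_coord. Qed.

Lemma measurable_sqdist c : measurable_fun setT (fun v => sqdist v c).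
Proof.
apply: measurable_sum => i; apply: measurable_funX; apply: measurable_funB => //.
exact: measurable_row_coord.
Qed.

Lemma measurable_dotv c : measurable_fun setT (fun v => dotv c v).
Proof.
apply: measurable_sum => i; apply: measurable_funM => //.
exact: measurable_row_coord.
Qed.

Lemma normal_densityE y c s : normal_density y c s =
  (2 * pi * s ^+ 2) `^ (- (n%:R / 2)) * expR (- (sqdist y c / (2 * s ^+ 2))).
Proof. by rewrite /normal_density dotvBE. Qed.

Lemma normal_densityC y c s : normal_density y c s = normal_density c y s.
Proof. by rewrite !normal_densityE sqdistC. Qed.

Lemma normal_density_gt0 y c s : 0 < s -> 0 < normal_density y c s.
Proof.
move=> s0; rewrite mulr_gt0 ?expR_gt0// powR_gt0// !mulr_gt0 ?pi_gt0//.
Qed.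

Lemma measurable_normal_density c s :
  measurable_fun setT (fun y => normal_density y c s).
Proof.
under eq_fun do rewrite normal_densityE.
apply: measurable_funM => //; apply: measurableT_comp => //.
apply: measurableT_comp => //; apply: measurable_funM => //.
exact: measurable_sqdist.
Qed.

Lemma measurable_box (I : 'I_n -> set (measurableTypeR R)) :
  (forall i, measurable (I i)) ->
  measurable [set v : 'rV[R]_n | forall i, I i (v ord0 i)].
Proof.
move=> mI; rewrite (_ : [set _ | _] =
    \bigcap_(i in [set: 'I_n]) (@rV_coord R n i) @^-1` I i); last first.
  by apply/seteqP; split => v /= H i; [move=> _|]; exact: H.
apply: fin_bigcap_measurable => // i _.
by rewrite -[X in measurable X]setTI; exact: measurable_rV_coord.
Qed.

(** A hyperplane is a box with one side reduced to a point; in the product of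
    the sides the factor 0 wins over the infinite ones. *)
Lemma lebesgue_rV_hyperplane (i : 'I_n) (a : R) :
  measurable [set v : 'rV[R]_n | v ord0 i = a] /\
  lebesgue_rV R n [set v | v ord0 i = a] = 0%E.
Proof.
pose I (j : 'I_n) : set (measurableTypeR R) :=
  if j == i then [set a] else setT.
have mI j : measurable (I j).
  by rewrite /I; case: ifP => // _; exact: measurable_set1.
have HE : [set v : 'rV[R]_n | v ord0 i = a] =
    [set v | forall j, I j (v ord0 j)].
  apply/seteqP; split => v /= vi; last by have := vi i; rewrite /I eqxx.
  by move=> j; rewrite /I; case: eqP => // ->.
split; first by rewrite HE; exact: measurable_box.
transitivity (lebesgue_rV R n [set v | forall j, I j (v ord0 j)]).
  exact: (congr1 (lebesgue_rV R n) HE).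
by rewrite lebesgue_rV_box// (bigD1 i)//= /I eqxx lebesgue_measure_set1 mul0e.
Qed.

Lemma cubeE c s : cube c s =
  [set v | forall i, `[c ord0 i - s / 2, c ord0 i + s / 2]%classic (v ord0 i)].
Proof.
by apply/seteqP; split => v /= vc i; have := vc i; rewrite in_itv/= ler_distl.
Qed.

Lemma measurable_cube c s : measurable (cube c s).
Proof.
rewrite cubeE; apply: (@measurable_box
  (fun i => `[c ord0 i - s / 2, c ord0 i + s / 2]%classic)) => i.
exact: measurable_itv.
Qed.

Lemma lebesgue_rV_cube c s : 0 <= s -> lebesgue_rV R n (cube c s) = (s ^+ n)%:E.
Proof.
move=> s0; rewrite cubeE (@lebesgue_rV_box R n
  (fun i => `[c ord0 i - s / 2, c ord0 i + s / 2]%classic)).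
  rewrite -[X in _ = (_ ^+ X)%:E]card_ord -prodr_const -prodEFin.
  apply: eq_bigr => i _; rewrite lebesgue_measure_itv/= lte_fin.
  case: ltP => [_|]; first by rewrite -EFinB; congr EFin; lra.
  by move=> ?; congr EFin; lra.
by move=> i; exact: measurable_itv.
Qed.

Lemma measurable_cell c s : measurable (cell c s).
Proof.
rewrite (_ : cell c s = [set v | forall i,
    `[c ord0 i - s / 2, c ord0 i + s / 2[%classic (v ord0 i)]); last first.
  by apply/seteqP; split => v /= vc i; have := vc i; rewrite in_itv.
apply: (@measurable_box
  (fun i => `[c ord0 i - s / 2, c ord0 i + s / 2[%classic)) => i.
exact: measurable_itv.
Qed.

Lemma measurable_unit_cube : measurable (@unit_cube R n).
Proof.
rewrite (_ : unit_cube n = [set v : 'rV[R]_n | forall i,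
    `[0, 1]%classic (v ord0 i)]); last first.
  by apply/seteqP; split => v /= vc i; have := vc i; rewrite in_itv.
apply: (@measurable_box (fun=> `[0, 1]%classic)) => i; exact: measurable_itv.
Qed.

Lemma lebesgue_rV_unit_cube_cell c s : 0 < s ->
  lebesgue_rV R n (unit_cube_cell c s) = (s ^+ n)%:E.
Proof.
move=> s0; pose I (i : 'I_n) : set (measurableTypeR R) :=
  if c ord0 i + s / 2 == 1 then `[c ord0 i - s / 2, c ord0 i + s / 2]%classic
  else `[c ord0 i - s / 2, c ord0 i + s / 2[%classic.
rewrite (_ : unit_cube_cell c s = [set v | forall i, I i (v ord0 i)]).
  rewrite lebesgue_rV_box.
    rewrite -[X in _ = (_ ^+ X)%:E]card_ord -prodr_const -prodEFin.
    apply: eq_bigr => i _.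
    have cs : c ord0 i - s / 2 < c ord0 i + s / 2 by lra.
    by rewrite /I; case: ifP => _;
      rewrite lebesgue_measure_itv/= lte_fin cs -EFinB; congr EFin; lra.
  by move=> i; rewrite /I; case: ifP => _; exact: measurable_itv.
apply/seteqP; split => v /= vc i; have := vc i; rewrite /I.
  move=> [v1 v2]; case: eqP => c1 /=; rewrite in_itv/= v1/=.
    by case: v2 => [/ltW//|[-> ->]].
  by case: v2 => // -[].
case: eqP => c1 /=; rewrite in_itv/= => /andP[-> v1]; split => //; last by left.
by move: v1; rewrite le_eqVlt => /predU1P[->|]; [right|left].
Qed.

End row_vectors.

(** * Gaussian integrals *)

Section gaussian_integral.
Variable R : realType.

(** Tonelli for the recursive definition of Lebesgue measure: it is what allows
    inductions on the dimension. *)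
Lemma ge0_integral_lebesgue_rVS n (f : 'rV[R]_n.+1 -> \bar R) :
  measurable_fun setT f -> (forall v, 0 <= f v)%E ->
  (\int[lebesgue_rV R n.+1]_v f v =
   \int[lebesgue_measure]_t \int[lebesgue_rV R n]_v f (rV_cons (t, v)))%E.
Proof.
move=> mf f0; transitivity (\int[pushforward
    (@lebesgue_measure R \x lebesgue_rV R n)%E (@rV_cons R n)]_v f v)%E.
  exact: (@eq_measure_integral _ _ R _
    (measure_function_pushforward__canonical__measure_function_Measure
      (@lebesgue_measure R \x lebesgue_rV R n)%E (@measurable_rV_cons R n))).
rewrite ge0_integral_pushforward//; last exact: measurable_rV_cons.
rewrite preimage_setT fubini_tonelli1//; last by move=> p; exact: f0.
by apply: measurableT_comp => //; exact: measurable_rV_cons.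
Qed.

Lemma normal_density_rV_cons n t (v : 'rV[R]_n) (c : 'rV[R]_n.+1) (s : R) :
  0 < s ->
  normal_density (rV_cons (t, v)) c s =
  normal_pdf (c ord0 ord0) s t *
  normal_density v (\row_j c ord0 (lift ord0 j)) s.
Proof.
move=> s0; rewrite !normal_densityE normal_pdfE ?gt_eqF// /sqdist.
have q0 : 0 < 2 * pi * s ^+ 2 by rewrite !mulr_gt0 ?pi_gt0 ?exprn_gt0.
rewrite big_ord_recl rV_cons0 /=.
under eq_bigr do rewrite rV_consS.
under [in RHS]eq_bigr do rewrite mxE.
set S := \sum_(i < n) _; set e := (t - _) ^+ 2.
rewrite [(e + S) / _]mulrDl opprD expRD /normal_fun /normal_peak.
rewrite [RHS]mulrACA; congr (_ * _); last first.
  by congr (_ * _); congr expR; rewrite mulNr; congr (- (_ / _)); rewrite mulr_natl.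
rewrite -powR12_sqrt; last by rewrite mulrn_wge0// mulr_ge0 ?sqr_ge0 ?pi_ge0.
have -> : s ^+ 2 * pi *+ 2 = 2 * pi * s ^+ 2 by rewrite -mulr_natl; ring.
rewrite -powRN -powRD; last by rewrite (gt_eqF q0) implybT.
by congr powR; rewrite -natr1; lra.
Qed.

Lemma integral_normal_density n (c : 'rV[R]_n) (s : R) : 0 < s ->
  (\int[lebesgue_rV R n]_v (normal_density v c s)%:E = 1)%E.
Proof.
move=> s0; elim: n c => [|n IHn] c.
  rewrite integral_dirac//; last first.
    apply/measurable_EFinP.
    exact: measurable_normal_density.
  by rewrite diracT mul1e normal_densityE /sqdist big_ord0 !mul0r !oppr0 powRr0
    expR0 mulr1.
rewrite ge0_integral_lebesgue_rVS//; last 2 first.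
- by apply/measurable_EFinP; exact: measurable_normal_density.
- by move=> v; rewrite lee_fin ltW// normal_density_gt0.
rewrite -(integral_normal_pdf (c ord0 ord0) s).
apply: eq_integral => t _.
under eq_integral do rewrite normal_density_rV_cons// EFinM.
rewrite ge0_integralZl//.
- by rewrite IHn mule1.
- by apply/measurable_EFinP; exact: measurable_normal_density.
- by move=> v _; rewrite lee_fin ltW// normal_density_gt0.
- by rewrite lee_fin normal_pdf_ge0.
Qed.

End gaussian_integral.

Section gaussian_bounds.
Variables (R : realType) (n : nat).
Implicit Types (c y z : 'rV[R]_n) (s h K : R).

(** Comparison of the values at y of the normal densities centered at c and at
    z, for c near z and z in a cube around y: in each coordinate the exponent
    changes by at most (2 (K s) (h / 2) + (h / 2)^2) / (2 s^2), which is small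
    when h / s is. *)
Lemma normal_density_shift_ge y z c s h K : 0 < s -> 0 <= h -> 0 <= K ->
  (forall i, `|z ord0 i - y ord0 i| <= K * s) ->
  (forall i, `|c ord0 i - z ord0 i| <= h / 2) ->
  expR (- (n%:R * (K * (h / s) / 2 + (h / s) ^+ 2 / 8))) * normal_density y z s
    <= normal_density y c s.
Proof.
move=> s0 h0 K0 zy cz; rewrite !normal_densityE mulrCA ler_wpM2l ?powR_ge0//.
rewrite -expRD ler_expR -opprD lerN2.
have s2 : 0 < 2 * s ^+ 2 by rewrite mulr_gt0 ?exprn_gt0.
rewrite ler_pdivrMr// mulrDl divfK ?gt_eqF//.
have -> : n%:R * (K * (h / s) / 2 + (h / s) ^+ 2 / 8) * (2 * s ^+ 2) =
    \sum_(i < n) (K * s * h + h ^+ 2 / 4).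
  by rewrite sumr_const card_ord -mulr_natl; field; rewrite gt_eqF.
rewrite -big_split/=; apply: ler_sum => i _.
have := zy i; have := cz i; set a := c ord0 i - _; set b := z ord0 i - _.
have -> : (y ord0 i - c ord0 i) = - (a + b) by rewrite /a /b; ring.
have -> : (y ord0 i - z ord0 i) = - b by rewrite /b; ring.
move=> ah bK; rewrite !sqrrN.
have a2 : a ^+ 2 <= (h / 2) ^+ 2 by rewrite -real_normK ?num_real// lerXn2r ?nnegrE ?divr_ge0.
have ab : a * b <= h / 2 * (K * s).
  by apply: (le_trans (ler_norm _)); rewrite normrM ler_pM.
by lra.
Qed.

Lemma normal_density_ge y c s : 0 < s ->
  (forall i, `|y ord0 i - c ord0 i| <= 3 / 2 * s) ->
  (2 * pi * s ^+ 2) `^ (- (n%:R / 2)) * expR (- (n%:R * (9 / 8)))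
    <= normal_density y c s.
Proof.
move=> s0 yc; rewrite normal_densityE ler_wpM2l ?powR_ge0// ler_expR lerN2.
have s2 : 0 < 2 * s ^+ 2 by rewrite mulr_gt0 ?exprn_gt0.
rewrite ler_pdivrMr// (_ : n%:R * (9 / 8) * (2 * s ^+ 2) = \sum_(i < n) (3 / 2 * s) ^+ 2); last first.
  by rewrite sumr_const card_ord -mulr_natl; field.
apply: ler_sum => i _; rewrite -real_normK ?num_real// lerXn2r ?nnegrE//.
by rewrite mulr_ge0 ?divr_ge0// ltW.
Qed.

(** Outside the cube the squared distance q to c exceeds (K s)^2.  Splitting
    exp (- q / (2 s^2)) into two equal factors, one is at most exp (- K^2 / 4)
    and the other is, up to normalization, the normal density of scale
    sqrt 2 * s, of total mass 1. *)
Lemma integral_normal_density_cube_ge c s K : 0 < s -> 0 <= K ->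
  ((1 - 2 `^ (n%:R / 2) * expR (- (K ^+ 2 / 4)))%:E <=
   \int[lebesgue_rV R n]_(v in cube c (2 * (K * s))) (normal_density v c s)%:E)%E.
Proof.
move=> s0 K0; set D := cube _ _.
have mD : measurable D by exact: measurable_cube.
have mnd t : measurable_fun setT
    (fun v : 'rV[R]_n => (normal_density v c t)%:E).
  by apply/measurable_EFinP; exact: measurable_normal_density.
have nd0 t v : 0 < t -> (0 <= (normal_density v c t)%:E)%E.
  by move=> t0; rewrite lee_fin ltW// normal_density_gt0.
pose t := Num.sqrt 2 * s.
have t0 : 0 < t by rewrite mulr_gt0// sqrtr_gt0.
have tail : (\int[lebesgue_rV R n]_(v in ~` D) (normal_density v c s)%:E <=
    (2 `^ (n%:R / 2) * expR (- (K ^+ 2 / 4)))%:E)%E.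
  rewrite -[leRHS]mule1 -(integral_normal_density c t0) -ge0_integralZl//; last first.
    by move=> v _; exact: nd0.
  apply: (@le_trans _ _ (\int[lebesgue_rV R n]_(v in ~` D)
      ((2 `^ (n%:R / 2) * expR (- (K ^+ 2 / 4)))%:E *
       (normal_density v c t)%:E)))%E; last first.
    apply: ge0_subset_integral => //; first exact: measurableC.
    - exact: measurable_funeM.
    - move=> v _; apply: mule_ge0; last exact: nd0.
      by rewrite lee_fin mulr_ge0 ?powR_ge0 ?expR_ge0.
  apply: ge0_le_integral; first exact: measurableC.
  - by move=> v _; exact: nd0.
  - exact: measurable_funTS.
  - by apply: measurable_funTS; exact: measurable_funeM.
  move=> v Dv; rewrite -EFinM lee_fin.
  have [i vi] : exists i, K * s < `|v ord0 i - c ord0 i|.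
    apply: contrapT => /forallNP H; apply: Dv => i.
    by rewrite leNgt; apply/negP => vi; apply: (H i); lra.
  rewrite !normal_densityE exprMn sqr_sqrtr//.
  have q0 : 0 < 2 * pi * s ^+ 2 by rewrite !mulr_gt0 ?pi_gt0 ?exprn_gt0.
  set P := 2 * pi * s ^+ 2 in q0 *.
  have -> : 2 * pi * (2 * s ^+ 2) = 2 * P by rewrite /P; ring.
  rewrite (powRM _ _ (ltW q0))//.
  have p2 : (2 : R) `^ (n%:R / 2) * 2 `^ (- (n%:R / 2)) = 1.
    by rewrite powRN mulfV// gt_eqF// powR_gt0.
  rewrite [leRHS](_ : _ =
    (2 `^ (n%:R / 2) * 2 `^ (- (n%:R / 2))) * (P `^ (- (n%:R / 2)) *
     (expR (- (K ^+ 2 / 4)) * expR (- (sqdist v c / (2 * (2 * s ^+ 2))))))); last first.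
    by ring.
  rewrite p2 mul1r ler_wpM2l ?powR_ge0// -expRD ler_expR -opprD lerN2.
  have s2 : 0 < 2 * (2 * s ^+ 2) by rewrite !mulr_gt0 ?exprn_gt0.
  have Ks : (K * s) ^+ 2 <= sqdist v c.
    apply: le_trans (sqr_coord_le_sqdist v c i).
    rewrite -[leRHS]real_normK ?num_real// lerXn2r ?nnegrE//; last exact: ltW.
    exact: mulr_ge0 (ltW s0).
  have -> : sqdist v c / (2 * s ^+ 2) = 2 * sqdist v c / (2 * (2 * s ^+ 2)).
    by field; rewrite gt_eqF.
  rewrite -lerBrDr -mulrBl ler_pdivlMr// [leLHS](_ : _ = (K * s) ^+ 2).
    by rewrite mulr_natl mulr2n addrK.
  by rewrite exprMn; field.
rewrite EFinB leeBlDr// -(integral_normal_density c s0) -(setUv D).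
rewrite ge0_integral_setU//=; last 4 first.
- exact: measurableC.
- by rewrite setUv.
- by move=> v _; exact: nd0.
- by rewrite disj_set2E setICr.
by rewrite leeD2l.
Qed.

End gaussian_bounds.

(** * Lower integrals and densities *)

Section integration.
Context d (T : measurableType d) (R : realType).
Local Open Scope ereal_scope.
Implicit Types (mu P : {measure set T -> \bar R}) (D : set T).

(** The integral of a nonnegative function, measurable or not, is a supremum over
    the simple functions below it. *)
Lemma ge0_le_lower_integral mu D (f g : T -> \bar R) :
  (forall x, D x -> 0 <= f x) -> (forall x, D x -> f x <= g x) ->
  \int[mu]_(x in D) f x <= \int[mu]_(x in D) g x.
Proof.
move=> f0 fg; have g0 x : D x -> 0 <= g x.
  by move=> Dx; exact: le_trans (f0 x Dx) (fg x Dx).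
rewrite !ge0_integralE//; apply: ge_ereal_sup => _ [h/= hf <-].
apply: ereal_sup_ubound; exists h => //= x.
by apply: (le_trans (hf x)); rewrite !patchE; case: ifPn => // /set_mem; exact: fg.
Qed.

Import HBNNSimple.

(** The change of density formula: simple functions approximate g from below,
    and both sides are continuous along increasing limits. *)
Lemma ge0_integral_density mu P (k : T -> \bar R) :
  measurable_fun setT k -> (forall x, 0 <= k x) ->
  (forall E, measurable E -> P E = \int[mu]_(x in E) k x) ->
  forall D (g : T -> \bar R), measurable D -> measurable_fun D g ->
  (forall x, D x -> 0 <= g x) ->
  \int[P]_(x in D) g x = \int[mu]_(x in D) (g x * k x).
Proof.
move=> mk k0 PE D g mD mg g0.
have mkD : measurable_fun D k by exact: measurable_funTS.
pose g_ := nnsfun_approx mD mg.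
transitivity (limn (fun n => \int[P]_(x in D) (g_ n x)%:E)).
  rewrite -monotone_convergence//.
  - apply: eq_integral => y /[!inE] yD; apply/esym/cvg_lim => //.
    exact: cvg_nnsfun_approx.
  - by move=> n; exact/measurable_EFinP/measurable_funTS.
  - by move=> n y _; rewrite lee_fin.
  - by move=> y _ m n mn; rewrite lee_fin; exact/lefP/nd_nnsfun_approx.
rewrite [X in limn X](_ : _ =
    (fun n => \int[mu]_(x in D) ((g_ n x)%:E * k x))).
  rewrite -monotone_convergence//; last 3 first.
    - move=> n; apply: emeasurable_funM => //.
      exact/measurable_EFinP/measurable_funTS.
    - by move=> n x _ /=; rewrite mule_ge0// lee_fin.
    - move=> x _ m n mn; rewrite lee_wpmul2r// lee_fin.
      exact/lefP/nd_nnsfun_approx.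
  apply: eq_integral => x /[!inE] Dx /=; apply/cvg_lim => //.
  have gx : (g_ n x)%:E @[n --> \oo] --> g x by exact: cvg_nnsfun_approx.
  have ndg : {homo (fun n => (g_ n x)%:E * k x) : m n / (m <= n)%N >-> m <= n}.
    move=> m n mn; rewrite lee_wpmul2r// lee_fin.
    exact/lefP/nd_nnsfun_approx.
  have [kx0|kx0] := eqVneq (k x) 0.
    by rewrite kx0 mule0; under eq_fun do rewrite mule0; exact: cvg_cst.
  have /eqP gxE : ereal_sup (range (fun n => (g_ n x)%:E)) == g x.
    apply/eqP; apply: cvg_unique gx => //.
    apply: ereal_nondecreasing_cvgn => m n mn; rewrite lee_fin.
    exact/lefP/nd_nnsfun_approx.
  case kxE : (k x) => [r| |] //; last by have := k0 x; rewrite kxE.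
    by under eq_fun do rewrite muleC; rewrite muleC; exact: cvgeZl.
  have [gx0|gx0] := eqVneq (g x) 0.
    rewrite gx0 mul0e; have g_0 n : (g_ n x)%:E = 0.
      apply/eqP; rewrite eq_le -{1}gx0 -gxE lee_fin fun_ge0 andbT.
      by apply: ereal_sup_ubound; exists n.
    by under eq_fun do rewrite g_0 mul0e; exact: cvg_cst.
  have gxp : 0 < g x by rewrite lt_neqAle eq_sym gx0 g0.
  have [n gn0] : exists n, (0 < g_ n x)%R.
    move: gxp; rewrite -gxE => /ereal_sup_gt[_ [n _ <-]]; rewrite lte_fin.
    by exists n.
  rewrite gt0_muley//; apply: cvg_near_cst; exists n => // p /= np.
  rewrite gt0_muley// lte_fin (lt_le_trans gn0)//.
  exact/lefP/nd_nnsfun_approx.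
apply/funext => n.
have mfn r : measurable (g_ n @^-1` [set r]) by [].
transitivity (\sum_(r \in range (g_ n))
    \int[mu]_(x in D) (r%:E * (\1_(g_ n @^-1` [set r]) x)%:E * k x)).
  under eq_integral do rewrite fimfunE -fsumEFin//.
  rewrite ge0_integral_fsum//; last 2 first.
  - by move=> y; exact/measurable_EFinP/measurable_funM.
  - by move=> y x _; rewrite nnfun_muleindic_ge0.
  apply: eq_fsbigr => r _; rewrite integralZl_indic_nnsfun// integral_indic//=.
  have [r0|r0] := leP 0%R r.
    under [RHS]eq_integral do rewrite -muleA.
    rewrite ge0_integralZl//; last 2 first.
    - apply: emeasurable_funM => //; apply/measurable_EFinP.
      exact: measurable_funTS.
    - by move=> x _; rewrite mule_ge0// lee_fin.
    congr (_ * _); rewrite PE//; last exact: measurableI.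
    rewrite setIC integral_mkcondr; apply: eq_integral => x _.
    rewrite patchE indicE; case: ifPn => xE; first by rewrite mul1e.
    by rewrite mul0e.
  rewrite preimage_nnfun0// set0I measure0 mule0.
  under eq_integral do rewrite indicE in_set0 mule0 mul0e.
  by rewrite integral0.
rewrite -ge0_integral_fsum//.
- apply: eq_integral => x _; rewrite [in RHS]fimfunE -fsumEFin//.
  rewrite ge0_mule_fsuml// => r; exact: nnfun_muleindic_ge0.
- move=> r; apply: emeasurable_funM => //.
  by apply/measurable_EFinP/measurable_funM => //; exact: measurable_funTS.
- by move=> r x _; rewrite mule_ge0// -EFinM nnfun_muleindic_ge0.
Qed.

(** Dominated convergence under an envelope G that need not be measurable.  The
    supremum u of the functions (L_n^+ - H)^+ is measurable and below G^+, so it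
    has a finite integral, and u + H is a genuine integrable bound for all the
    L_n^+.  The negative parts follow since their integrals are controlled by
    those of the positive parts. *)
Lemma cvg_integral_lower_dominated mu D (L : (T -> \bar R)^nat)
    (G : T -> \bar R) (H : T -> R) :
  measurable D -> (forall n, measurable_fun D (L n)) ->
  {ae mu, forall x, D x -> (L n)^\+ x @[n --> \oo] --> 0} ->
  (forall n, \int[mu]_(x in D) (L n)^\- x <= \int[mu]_(x in D) (L n)^\+ x) ->
  \int[mu]_(x in D) G x < +oo -> \int[mu]_(x in D) G^\- x = 0 ->
  mu.-integrable D (EFin \o H) ->
  (\forall n \near \oo, forall x, D x -> (L n)^\+ x <= G^\+ x + (H x)%:E) ->
  \int[mu]_(x in D) L n x @[n --> \oo] --> 0.
Proof.
move=> mD mL L0 Lneg Goo Gneg iH [n0 _ dom].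
have mH : measurable_fun D (EFin \o H) by exact: measurable_int iH.
have mLp n : measurable_fun D (L n)^\+ by exact: measurable_funepos.
pose v n x := maxe ((L (n + n0)%N)^\+ x - (H x)%:E) 0.
have mv n : measurable_fun D (v n).
  apply: measurable_maxe; last exact: measurable_cst.
  by apply: emeasurable_funB.
pose u x := esups (v ^~ x) 0%N.
have mu_ : measurable_fun D u by exact: measurable_fun_esups.
have vu n x : v n x <= u x by apply: ereal_sup_ubound; exists n.
have u0 x : 0 <= u x.
  by apply: le_trans (vu 0%N x); rewrite /v le_max lexx orbT.
have uG x : D x -> u x <= G^\+ x.
  move=> Dx; apply: ge_ereal_sup => _ [n _ <-].
  rewrite /v ge_max funepos_ge0 andbT leeBlDr//.
  by apply: dom => //=; rewrite leq_addl.
have iuoo : \int[mu]_(x in D) u x < +oo.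
  apply: (@le_lt_trans _ _ (\int[mu]_(x in D) G^\+ x)).
    exact: ge0_le_lower_integral.
  by move: Goo; rewrite integralE Gneg sube0.
have iu : mu.-integrable D u.
  apply/integrableP; split => //.
  by under eq_integral do rewrite gee0_abs//.
have iuH : mu.-integrable D (u \+ (EFin \o H)) by exact: integrableD.
have Ldom n x : D x -> (L (n + n0)%N)^\+ x <= u x + (H x)%:E.
  move=> Dx; rewrite -leeBlDr//; apply: le_trans (vu n x).
  by rewrite /v le_max lexx.
have Lp0 : \int[mu]_(x in D) (L n)^\+ x @[n --> \oo] --> 0.
  rewrite -(cvg_shiftn n0).
  have [] := @dominated_convergence _ T R mu D mD
    (fun n => (L (n + n0)%N)^\+) (cst 0) (u \+ (EFin \o H)).
  - by move=> n; exact: mLp.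
  - exact: measurable_cst.
  - apply: filterS L0 => x Lx Dx; have := Lx Dx.
    by rewrite -(cvg_shiftn n0).
  - exact: iuH.
  - apply: aeW => x n Dx; rewrite gee0_abs; [exact: Ldom|exact: funepos_ge0].
  by move=> _ _; rewrite integral0.
apply: (@squeeze_cvge _ _ _ _
    (fun n => - \int[mu]_(x in D) (L n)^\+ x) _
    (fun n => \int[mu]_(x in D) (L n)^\+ x)) => //.
- apply: nearW => n; rewrite (integralE _ _ (L n)); have Ln := Lneg n.
  have Lp_ge0 : 0 <= \int[mu]_(x in D) (L n)^\+ x.
    by apply: integral_ge0 => x _; exact: funepos_ge0.
  have Ln_ge0 : 0 <= \int[mu]_(x in D) (L n)^\- x.
    by apply: integral_ge0 => x _; exact: funeneg_ge0.
  apply/andP; split.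
    rewrite -[leLHS]add0e; apply: leeD => //.
    by rewrite leeN2.
  by rewrite -[leRHS]sube0; apply: leeB.
- by rewrite -[X in _ --> X]oppe0; exact: cvgeN.
Qed.

End integration.

Definition density_measure d (T : measurableType d) (R : realType)
    (mu : {measure set T -> \bar R}) (k : T -> \bar R)
    (mk : measurable_fun setT k) (k0 : forall x, (0 <= k x)%E) (E : set T) :=
  (\int[mu]_(x in E) k x)%E.

Section density_measure.
Context d (T : measurableType d) (R : realType).
Variables (mu : {measure set T -> \bar R}) (k : T -> \bar R).
Hypotheses (mk : measurable_fun setT k) (k0 : forall x, (0 <= k x)%E).

Let density_measure0 : density_measure mu mk k0 set0 = 0%E.
Proof. exact: integral_set0. Qed.

Let density_measure_ge0 E : (0 <= density_measure mu mk k0 E)%E.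
Proof. by apply: integral_ge0 => x _; exact: k0. Qed.

Let density_measure_sigma_additive :
  semi_sigma_additive (density_measure mu mk k0).
Proof.
move=> E mE tE mUE; rewrite /density_measure ge0_integral_bigcup//; last first.
  exact: measurable_funTS.
apply: is_cvg_ereal_nneg_natsum => n _; exact: density_measure_ge0.
Qed.

HB.instance Definition _ := isMeasure.Build _ _ _ (density_measure mu mk k0)
  density_measure0 density_measure_ge0 density_measure_sigma_additive.

End density_measure.

Section disintegration.
Context d1 d2 (T1 : measurableType d1) (T2 : measurableType d2) (R : realType).
Local Open Scope ereal_scope.
Implicit Types (lam : {sigma_finite_measure set T1 -> \bar R})
  (nu : {measure set T2 -> \bar R}) (F : probability (T1 * T2)%type R).

Lemma ge0_integral_setX lam (rho : {sigma_finite_measure set T2 -> \bar R})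
    (k : T1 * T2 -> \bar R) A B :
  measurable A -> measurable B -> measurable_fun setT k ->
  (forall z, 0 <= k z) ->
  measurable_fun setT (fun x => \int[lam]_(y in A) k (y, x)) /\
  \int[lam \x rho]_(z in A `*` B) k z =
  \int[rho]_(x in B) \int[lam]_(y in A) k (y, x).
Proof.
move=> mA mB mk k0; have mAB : measurable (A `*` B) by exact: measurableX.
split.
  have mkA : measurable_fun setT (k \_ (A `*` setT)).
    apply/(measurable_restrictT _ _).1; first exact: measurableX.
    exact: measurable_funTS.
  have := @measurable_fun_fubini_tonelli_G _ _ T1 T2 R lam _ mkA.
  move/(_ (fun z => erestrict_ge0 (fun z _ => k0 z) z)).
  congr (measurable_fun _ _); apply/funext => x; rewrite /fubini_G.
  rewrite [RHS]integral_mkcond; apply: eq_integral => y _.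
  rewrite !patchE; congr (if _ then _ else _).
  by apply/idP/idP => /set_mem H; apply/mem_set; [case: H|split].
rewrite integral_mkcond fubini_tonelli2//=; last 2 first.
- by apply/(measurable_restrictT _ _).1 => //; exact: measurable_funTS.
- exact: erestrict_ge0.
rewrite [RHS]integral_mkcond; apply: eq_integral => x _.
rewrite /fubini_G patchE; case: ifPn => xB.
  rewrite [RHS]integral_mkcond; apply: eq_integral => y _.
  rewrite !patchE; congr (if _ then _ else _).
  apply/idP/idP => /set_mem H; apply/mem_set; first by case: H.
  by split => //; exact: set_mem.
rewrite integral0_eq// => y _; rewrite patchE ifN//.
by apply: contra xB => /set_mem[_ /= xB]; exact: mem_set.
Qed.

(** The product formula on rectangles makes f the density of F with respect to
    the product of lam and the marginal law rho of x.  On a rectangle, Tonelli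
    reduces the claim to the product formula, because rho has density g with
    respect to nu; rectangles generate the product sigma-algebra and are stable
    under intersection, hence equality of the two measures.  Passing to rho is
    what makes Tonelli available, as nu is not assumed sigma-finite. *)
Lemma conditional_density_joint lam nu F (Y : set T1) (X : set T2)
    (f : T1 -> T2 -> R) (g : T2 -> R) (mY : measurable Y) (mX : measurable X)
    (k := (fun z => (f z.1 z.2)%:E) \_ (Y `*` X)) :
  F (Y `*` X) = 1 ->
  (forall y x, Y y -> X x -> (0 <= f y x)%R) ->
  measurable_fun (Y `*` X) (fun z => f z.1 z.2) ->
  (forall x, X x -> \int[lam]_(y in Y) (f y x)%:E = 1) ->
  (forall x, X x -> (0 <= g x)%R) ->
  measurable_fun X g ->
  (forall A B, measurable A -> measurable B -> A `<=` Y -> B `<=` X ->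
    F (A `*` B) =
    \int[nu]_(x in B) ((\int[lam]_(y in A) (f y x)%:E) * (g x)%:E)) ->
  exists rho : probability T2 R,
    forall E, measurable E -> F E = \int[lam \x rho]_(z in E) k z.
Proof.
move=> FYX f0 mf intf g0 mg FAB.
have mYX : measurable (Y `*` X) by exact: measurableX.
have mk : measurable_fun setT k.
  by apply/(measurable_restrictT _ _).1 => //; exact/measurable_EFinP.
have k0 z : 0 <= k z.
  by apply: erestrict_ge0 => -[y x] [/= Yy Xx]; rewrite lee_fin f0.
pose gX := (EFin \o g) \_ X.
have mgX : measurable_fun setT gX.
  by apply/(measurable_restrictT _ _).1 => //; exact/measurable_EFinP.
have gX0 x : 0 <= gX x.
  by apply: erestrict_ge0 => t Xt; rewrite lee_fin g0.
have FC : F (~` (Y `*` X)) = 0 by rewrite probability_setC// FYX subee.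
have FI E : measurable E -> F E = F (E `&` (Y `*` X)).
  move=> mE; rewrite (measureDI F mE mYX) [X in X + _](_ : _ = 0) ?add0e//.
  apply: (subset_measure0 _ _ _ FC); [exact: measurableD|exact: measurableC|].
  by move=> z [].
pose snd_mfun : {mfun (T1 * T2)%type >-> T2} :=
  HB.pack snd (isMeasurableFun.Build _ _ _ _ _ (@measurable_snd _ _ T1 T2)).
pose rho := distribution F snd_mfun.
have rhoE B : measurable B -> rho B = \int[nu]_(x in B) gX x.
  move=> mB; rewrite -[LHS]/(F (snd @^-1` B)) FI//; last first.
    by rewrite -[X in measurable X]setTI; exact: measurable_snd.
  rewrite (_ : _ `&` _ = Y `*` (B `&` X)); last first.
    by apply/seteqP; split => -[y x] /=; tauto.
  rewrite FAB//; [|exact: measurableI].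
  rewrite /gX -integral_mkcondr; apply: eq_integral => x /set_mem[_ Xx].
  by rewrite intf// mul1e.
exists rho.
have FrectE A B : measurable A -> measurable B ->
    F (A `*` B) = \int[lam \x rho]_(z in A `*` B) k z.
  move=> mA mB; have [mkA ->] := ge0_integral_setX lam rho mA mB mk k0.
  rewrite (ge0_integral_density mgX gX0 rhoE)//; last 2 first.
  - exact: measurable_funTS.
  - by move=> x _; apply: integral_ge0 => y _; exact: k0.
  rewrite FI; last exact: measurableX.
  rewrite -setXI FAB//; [|exact: measurableI|exact: measurableI].
  rewrite integral_mkcondr; apply: eq_integral => x xB.
  rewrite /gX !patchE; case: ifPn => xX; last by rewrite mule0.
  congr (_ * _); rewrite integral_mkcondr; apply: eq_integral => y yA.
  rewrite /k !patchE; congr (if _ then _ else _).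
  apply/idP/idP => [yY|/set_mem[]/=]; last by move=> yY _; exact: mem_set.
  by apply/mem_set; split => /=; exact: set_mem.
move=> E mE.
pose C : set (set (T1 * T2)) :=
  [set C | exists A, measurable A /\ exists B, measurable B /\ C = A `*` B].
apply: (measure_unique C (fun=> setT) _ _ _ _ F
    (density_measure (lam \x rho) mk k0)) => //.
- rewrite measurable_prod_measurableType //; congr (<<s _ >>).
  rewrite predeqE; split => [[A mA [B mB <-]]|[A [mA [B [mB ->]]]]].
    by exists A; split => //; exists B.
  by exists A => //; exists B.
- move=> _ _ [X1 [mX1 [X2 [mX2 ->]]]] [Y1 [mY1 [Y2 [mY2 ->]]]].
  rewrite -setXI; exists (X1 `&` Y1); split; first exact: measurableI.
  by exists (X2 `&` Y2); split => //; exact: measurableI.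
- by move=> _; exists setT; split => //; exists setT; rewrite setXTT.
- by apply/seteqP; split => // z _; exists 0%N.
- by move=> A [A1 [mA1 [A2 [mA2 ->]]]]; exact: FrectE.
- by move=> _; apply: (le_lt_trans (probability_le1 F measurableT)); rewrite ltry.
Qed.

End disintegration.

Lemma measurable_fun_inv_gt0 d (T : measurableType d) (R : realType)
    (D : set T) (f : T -> R) :
  measurable_fun D f -> (forall z, D z -> 0 < f z) ->
  measurable_fun D (fun z => (f z)^-1).
Proof.
move=> mf f0; apply: (eq_measurable_fun (fun z => expR (- ln (f z)))).
  by move=> z /set_mem/f0 fz; rewrite expRN lnK.
apply: measurableT_comp => //; apply: measurableT_comp => //.
exact: measurableT_comp.
Qed.

Section log_ratio.
Context d (T : measurableType d) (R : realType).
Local Open Scope ereal_scope.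
Variables (D : set T) (f p : T -> R).
Hypotheses (mD : measurable D) (mf : measurable_fun D f)
  (mp : measurable_fun D p).
Hypotheses (f0 : forall z, D z -> (0 <= f z)%R)
  (p0 : forall z, D z -> (0 < p z)%R).

Let L z := lne ((f z)%:E / (p z)%:E).

Lemma log_ratioE z : D z ->
  L z = if (f z <= 0)%R then -oo else (ln (f z / p z))%:E.
Proof.
move=> Dz; rewrite /L inver gt_eqF ?p0// -EFinM.
case: ifPn => [fz|]; first by rewrite le0_lneNy// lee_fin pmulr_lle0// invr_gt0 p0.
by rewrite -ltNge => fz; rewrite lne_EFin// divr_gt0// p0.
Qed.

Let mfp : measurable_fun D (fun z => f z / p z)%R.
Proof.
apply: measurable_funM => //.
exact: measurable_fun_inv_gt0.
Qed.

Lemma measurable_log_ratio : measurable_fun D L.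
Proof.
pose L' z := if (f z <= 0)%R then -oo else (ln (f z / p z))%:E.
apply: (eq_measurable_fun L') => [z /set_mem/log_ratioE//|].
apply: measurable_fun_if => //.
- exact: measurable_fun_ler.
- apply/measurable_EFinP; apply: measurableT_comp => //.
  by apply: measurable_funS mfp => // z [].
Qed.

(** Gibbs' inequality, in a form that is meaningful without integrability: with
    u = f / p, integrate (log u)^- + 1 <= 1 / u + (log u)^+ against P and use
    that the P-integral of p / f is at most the mu-integral of p. *)
Lemma integral_neg_log_ratio (mu P : {measure set T -> \bar R}) :
  P D = 1 ->
  (forall E, measurable E ->
    P E = \int[mu]_(z in E) (((EFin \o f) \_ D) z)) ->
  \int[mu]_(z in D) (p z)%:E <= 1 ->
  \int[P]_(z in D) L^\- z <= \int[P]_(z in D) L^\+ z.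
Proof.
move=> PD PE intp.
pose q z := if (f z <= 0)%R then +oo else (p z / f z)%:E.
have mq : measurable_fun D q.
  apply: measurable_fun_if => //; first exact: measurable_fun_ler.
  apply/measurable_EFinP; apply: measurable_funM.
    by apply: measurable_funS mp => // z [].
  apply: measurable_fun_inv_gt0; first by apply: measurable_funS mf => // z [].
  by move=> z [_ /= fz]; rewrite ltNge fz.
have q0 z : D z -> 0 <= q z.
  move=> Dz; rewrite /q; case: ifPn => // _.
  by rewrite lee_fin divr_ge0// ?f0// ltW// p0.
have mLp : measurable_fun D L^\+ by exact/measurable_funepos/measurable_log_ratio.
have mLn : measurable_fun D L^\- by exact/measurable_funeneg/measurable_log_ratio.
have Lq z : D z -> L^\- z + 1 <= q z + L^\+ z.
  move=> Dz; rewrite funeposE funenegE log_ratioE// /q.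
  have [fz|fz] := leP (f z) 0%R; first by rewrite (max_r (leNye 0)) adde0 leey.
  set u := (f z / p z)%R; have u0 : (0 < u)%R by rewrite divr_gt0// p0.
  have -> : (p z / f z = u^-1)%R by rewrite /u invf_div.
  have lnu : (1 - ln u <= u^-1)%R.
    have v0 : (0 < u^-1)%R by rewrite invr_gt0.
    have := @le_ln1Dx R (u^-1 - 1).
    rewrite (_ : 1 + (u^-1 - 1) = u^-1)%R ?lnV ?posrE//; last by ring.
    by move/(_ ltac:(lra)); lra.
  have [u1|u1] := leP 0%R (ln u).
    rewrite max_r ?EFinN ?oppe_le0 ?lee_fin// max_l ?lee_fin//.
    lra.
  have u1' := ltW u1; rewrite max_l ?oppe_ge0 ?lee_fin// max_r ?lee_fin//.
  lra.
have intq : \int[P]_(z in D) q z <= 1.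
  have mk : measurable_fun setT ((EFin \o f) \_ D).
    by apply/(measurable_restrictT _ _).1 => //; exact/measurable_EFinP.
  have k0 z : 0 <= ((EFin \o f) \_ D) z.
    by apply: erestrict_ge0 => t Dt; rewrite lee_fin f0.
  apply: le_trans intp; rewrite (ge0_integral_density mk k0 PE)//.
  apply: ge0_le_integral => //.
  - by move=> z Dz; rewrite mule_ge0// q0.
  - by apply: emeasurable_funM => //; exact: measurable_funTS.
  - exact/measurable_EFinP.
  - move=> z Dz; rewrite patchE mem_set//= /q; case: ifPn => fz.
      rewrite (_ : f z = 0%R) ?mule0 ?lee_fin ?ltW ?p0//.
      by apply/eqP; rewrite eq_le fz f0.
    rewrite -EFinM lee_fin divfK// gt_eqF// ltNge; exact: fz.
have Lp1 : \int[P]_(z in D) L^\- z + 1 <= 1 + \int[P]_(z in D) L^\+ z.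
  have -> : \int[P]_(z in D) L^\- z + 1 = \int[P]_(z in D) (L^\- z + 1).
    rewrite ge0_integralD//.
    by rewrite integral_cst// mul1e PD.
  apply: (@le_trans _ _ (\int[P]_(z in D) (q z + L^\+ z))).
    apply: ge0_le_integral => //.
    - by move=> z _; rewrite adde_ge0// funeneg_ge0.
    - exact: emeasurable_funD.
    - exact: emeasurable_funD.
  by rewrite ge0_integralD//; exact: leeD.
by move: Lp1; rewrite addeC leeD2lE.
Qed.

End log_ratio.

(** * Logit weights over a cubic partition of the unit cube *)

Section logit_weights.
Variables (R : realType) (n N : nat) (xc : 'I_N -> 'rV[R]_n).
Implicit Types (Rm s b : R) (x : 'rV[R]_n).

(** Multiplying numerator and denominator by exp (- R |x|^2) completes the
    squares: the weights decay with the distance of x to the centers. *)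
Lemma logit_weightE Rm i x : logit_weight Rm xc i x =
  expR (- (Rm * sqdist (xc i) x)) / \sum_(l < N) expR (- (Rm * sqdist (xc l) x)).
Proof.
have dE l : expR (- (Rm * (dotv (xc l) (xc l) - 2 * dotv (xc l) x))) =
    expR (Rm * dotv x x) * expR (- (Rm * sqdist (xc l) x)).
  rewrite -expRD; congr expR.
  have -> : sqdist (xc l) x =
      dotv (xc l) (xc l) - 2 * dotv (xc l) x + dotv x x.
    rewrite /sqdist /dotv mulr_sumr -sumrB -big_split/=.
    by apply: eq_bigr => k _; ring.
  by ring.
rewrite /logit_weight dE; under eq_bigr do rewrite dE.
by rewrite -mulr_sumr -mulf_div divff ?mul1r// gt_eqF// expR_gt0.
Qed.

Let sum_expR_gt0 Rm x (i : 'I_N) :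
  0 < \sum_(l < N) expR (- (Rm * sqdist (xc l) x)).
Proof.
rewrite (bigD1 i)//= ltr_pwDl ?expR_gt0//.
by apply: sumr_ge0 => l _; exact: expR_ge0.
Qed.

Lemma logit_weight_gt0 Rm i x : 0 < logit_weight Rm xc i x.
Proof. by rewrite logit_weightE divr_gt0 ?expR_gt0// (sum_expR_gt0 _ _ i). Qed.

Lemma sum_logit_weight Rm x : (0 < N)%N -> \sum_(i < N) logit_weight Rm xc i x = 1.
Proof.
move=> N0; under eq_bigr do rewrite logit_weightE.
by rewrite -mulr_suml divff// gt_eqF// (sum_expR_gt0 _ _ (Ordinal N0)).
Qed.

Lemma measurable_logit_weight Rm i : measurable_fun setT (logit_weight Rm xc i).
Proof.
apply: measurable_funM.
  apply: measurableT_comp => //; apply: measurableT_comp => //.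
  apply: measurable_funM => //; apply: measurable_funB => //.
  by apply: measurable_funM => //; exact: measurable_dotv.
apply: measurable_fun_inv_gt0.
  apply: measurable_sum => l.
  apply: measurableT_comp => //; apply: measurableT_comp => //.
  apply: measurable_funM => //; apply: measurable_funB => //.
  by apply: measurable_funM => //; exact: measurable_dotv.
move=> x _; rewrite (bigD1 i)//= ltr_pwDl ?expR_gt0//.
by apply: sumr_ge0 => l _; exact: expR_ge0.
Qed.

(** Compare each numerator with the single term of index i0 of the
    denominator. *)
Lemma sum_far_logit_weight_le Rm x (i0 : 'I_N) (a t : R) : 0 <= Rm ->
  sqdist (xc i0) x <= a ->
  \sum_(i < N | t < sqdist (xc i) x) logit_weight Rm xc i x <=
    N%:R * expR (- (Rm * (t - a))).
Proof.
move=> Rm0 i0a; rewrite -[X in X%:R]card_ord mulr_natl -sumr_const.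
rewrite [leRHS](bigID (fun i => t < sqdist (xc i) x))/= ler_wpDr//.
  by apply: sumr_ge0 => i _; exact: expR_ge0.
apply: ler_sum => i ti; rewrite logit_weightE ler_pdivrMr ?(sum_expR_gt0 _ _ i)//.
apply: (@le_trans _ _
    (expR (- (Rm * (t - a))) * expR (- (Rm * sqdist (xc i0) x)))).
  rewrite -expRD ler_expR -opprD lerN2 -mulrDr ler_wpM2l//; lra.
rewrite ler_wpM2l ?expR_ge0// (bigD1 i0)//= lerDl.
by apply: sumr_ge0 => l _; exact: expR_ge0.
Qed.

Lemma unit_cube_cell_sqdist x c b : unit_cube_cell c b x ->
  sqdist c x <= n%:R * b ^+ 2 / 4.
Proof.
move=> xB; rewrite (_ : _ / 4 = \sum_(i < n) (b / 2) ^+ 2); last first.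
  by rewrite sumr_const card_ord -mulr_natl; field.
apply: ler_sum => i _; have [x1 x2] := xB i.
have cx : `|c ord0 i - x ord0 i| <= b / 2.
  by rewrite ler_norml; apply/andP; split; [case: x2 => [?|[-> ?]]; lra|lra].
rewrite -real_normK ?num_real// lerXn2r ?nnegrE//.
exact: le_trans cx.
Qed.

End logit_weights.

Section unit_cube_partitions.
Variables (R : realType) (n N : nat).
Hypothesis n0 : (0 < n)%N.
Variables (b : R) (B : 'I_N -> set 'rV[R]_n) (xc : 'I_N -> 'rV[R]_n).
Hypotheses (b0 : 0 < b) (Bp : unit_cube_partition b B xc).
Hypothesis B_size : forall i, lebesgue_rV R n (B i) = ((N%:R^-1)%:E).

Lemma unit_cube_cell_cover x : unit_cube n x -> exists i, unit_cube_cell (xc i) b x.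
Proof.
by have [BE <- _] := Bp => -[i _]; rewrite BE => ?; exists i.
Qed.

Lemma unit_cube_partition_gt0 : (0 < N)%N.
Proof.
have [|i _] := @unit_cube_cell_cover 0; first by move=> i; rewrite mxE lexx ler01.
exact: leq_ltn_trans (ltn_ord i).
Qed.

Lemma unit_cube_center i : unit_cube n (xc i).
Proof.
have [BE <- _] := Bp; exists i => //; rewrite BE => k.
have b2 : 0 < b / 2 by rewrite divr_gt0.
by split; [rewrite gerBl ltW|left; rewrite ltrDl].
Qed.

Lemma unit_cube_side : b ^+ n = N%:R^-1.
Proof.
have [BE _ _] := Bp; have := B_size (Ordinal unit_cube_partition_gt0).
by rewrite BE lebesgue_rV_unit_cube_cell// => -[].
Qed.

Variables (s Rm : R).
Hypothesis s_def : forall i,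
  s = n%:R * fine (lebesgue_rV R n (B i)) `^ (2 / n%:R).

Lemma unit_cube_sqdiag : s = n%:R * b ^+ 2.
Proof.
have nR : n%:R != 0 :> R by rewrite pnatr_eq0 -lt0n.
rewrite (s_def (Ordinal unit_cube_partition_gt0)) B_size/= -unit_cube_side.
rewrite -!powR_mulrn ?(ltW b0)// -powRrM; congr (_ * _ `^ _).
by rewrite mulrC divfK.
Qed.

(** The center of the cell of x is at squared distance at most s / 4 from x, so
    the far weights sum to at most N exp (- (7 / 4) R s), and N is
    (n / s)^(n / 2) since s = n b^2 and N = b^(- n). *)
Lemma sum_near_logit_weight_ge x : 0 <= Rm -> unit_cube n x ->
  1 - n%:R `^ (n%:R / 2) * (expR (- (Rm * s)) / s `^ (n%:R / 2)) <=
  \sum_(i < N | sqdist (xc i) x <= 2 * s) logit_weight Rm xc i x.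
Proof.
move=> Rm0 Xx; have [i0 xi0] := unit_cube_cell_cover Xx.
have := unit_cube_cell_sqdist xi0; rewrite -unit_cube_sqdiag => xs.
have s0 : 0 < s by rewrite unit_cube_sqdiag mulr_gt0 ?exprn_gt0// ltr0n.
rewrite -[X in X - _](sum_logit_weight xc Rm x unit_cube_partition_gt0).
rewrite (bigID (fun i => sqdist (xc i) x <= 2 * s))/= lerBlDr lerD2l.
under eq_bigl do rewrite -ltNge.
apply: (le_trans (sum_far_logit_weight_le (2 * s) Rm0 xs)).
have NE : N%:R = (n%:R `^ (n%:R / 2)) / s `^ (n%:R / 2) :> R.
  rewrite unit_cube_sqdiag powRM ?ler0n ?sqr_ge0// invfM mulrA divff ?mul1r; last first.
    by rewrite gt_eqF// powR_gt0// ltr0n.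
  rewrite -[N%:R]invrK -unit_cube_side -!powR_mulrn ?(ltW b0)// -powRrM.
  by congr (_ `^ _)^-1; field.
rewrite NE [leRHS]mulrA [leRHS]mulrAC ler_wpM2l ?divr_ge0 ?powR_ge0//.
by rewrite ler_expR lerN2 ler_wpM2l//; lra.
Qed.

End unit_cube_partitions.

(** * The mixture over a fixed partition *)

Lemma bigcup_ordE (T : Type) (m : nat) (G : 'I_m -> set T) :
  \bigcup_j G j = \big[setU/set0]_(j < m) G j.
Proof.
rewrite -bigcup_seq; apply/seteqP; split => y [j _ Gy]; exists j => //=.
exact: mem_index_enum.
Qed.

Section mixture.
Variables (R : realType) (d dx : nat).
Variables (Y : set 'rV[R]_d) (X : set 'rV[R]_dx) (f : 'rV[R]_d -> 'rV[R]_dx -> R).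
Hypotheses (mY : measurable Y) (mX : measurable X).
Hypothesis f0 : forall y x, Y y -> X x -> 0 <= f y x.
Hypothesis mf : measurable_fun (Y `*` X) (fun z => f z.1 z.2).
Hypothesis intf : forall x, X x ->
  (\int[lebesgue_rV R d]_(y in Y) (f y x)%:E)%E = 1%E.

Lemma measurable_section x : X x -> measurable_fun Y (f ^~ x).
Proof.
move=> Xx; rewrite (_ : f ^~ x = (fun z => f z.1 z.2) \o (pair ^~ x))//.
apply: (measurable_comp (F := Y `*` X)) => //; first exact: measurableX.
  by move=> _ [y Yy <-].
by apply: measurable_funTS; exact: pair2_measurable.
Qed.

Let measurable_sectionE S x : S `<=` Y -> X x ->
  measurable_fun S (fun y => (f y x)%:E).
Proof.
move=> SY Xx; apply/measurable_EFinP.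
by apply: measurable_funS (measurable_section Xx).
Qed.

Lemma cond_probE S x : measurable S -> S `<=` Y -> X x ->
  ((cond_prob f S x)%:E = \int[lebesgue_rV R d]_(y in S) (f y x)%:E)%E.
Proof.
move=> mS SY Xx; rewrite /cond_prob /Rintegral fineK// ge0_fin_numE; last first.
  by apply: integral_ge0 => y /SY Yy; rewrite lee_fin f0.
apply: (@le_lt_trans _ _ 1%E); last by rewrite ltry.
rewrite -(intf Xx); apply: ge0_subset_integral => //.
- exact: measurable_sectionE.
- by move=> y Yy; rewrite lee_fin f0.
Qed.

Lemma cond_prob_ge0 S x : S `<=` Y -> X x -> 0 <= cond_prob f S x.
Proof.
move=> SY Xx; apply: fine_ge0.
by apply: integral_ge0 => y /SY Yy; rewrite lee_fin f0.
Qed.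

Lemma cond_prob_ge S D x (l v : R) : measurable S -> measurable D ->
  D `<=` S -> S `<=` Y -> X x -> 0 <= l -> (forall z, D z -> l <= f z x) ->
  lebesgue_rV R d D = v%:E -> l * v <= cond_prob f S x.
Proof.
move=> mS mD DS SY Xx l0 lf Dv; rewrite -lee_fin cond_probE// EFinM -Dv.
rewrite -integral_cst//.
apply: (@le_trans _ _ (\int[lebesgue_rV R d]_(y in D) (f y x)%:E)%E).
  apply: ge0_le_integral => //.
  by apply: measurable_sectionE => //; exact: subset_trans SY.
apply: ge0_subset_integral; [exact: mD|exact: mS| | |exact: DS].
  exact: measurable_sectionE.
by move=> z /SY Yz; rewrite lee_fin f0.
Qed.

Variables (m : nat) (h : R) (A0 : set 'rV[R]_d) (A : 'I_m -> set 'rV[R]_d)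
  (mu : 'I_m -> 'rV[R]_d).
Hypothesis A_part : cubic_grid_partition Y h A0 A mu.

Lemma measurable_grid_cell j : measurable (A j).
Proof. by have [AE _ _ _ _] := A_part; rewrite AE; exact: measurable_cell. Qed.

Lemma grid_cell_sub j : A j `<=` Y.
Proof. by have [_ _ <- _ _] := A_part => y Ay; right; exists j. Qed.

Lemma grid_rest_sub : A0 `<=` Y.
Proof. by have [_ _ <- _ _] := A_part => y Ay; left. Qed.

Lemma grid_cellsE : \bigcup_j A j = Y `\` A0.
Proof.
have [_ _ <- _ A0A] := A_part; apply/seteqP; split => y.
  move=> [j _ Ay]; split; first by right; exists j.
  by move=> A0y; have : (A0 `&` A j) y by []; rewrite A0A.
by move=> [[//|]].
Qed.

Lemma measurable_grid_rest : measurable A0.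
Proof.
rewrite (_ : A0 = Y `\` \bigcup_j A j).
  apply: measurableD => //; rewrite bigcup_ordE.
  by apply: bigsetU_measurable => j _; exact: measurable_grid_cell.
rewrite grid_cellsE setDD; apply/esym/setIidPr; exact: grid_rest_sub.
Qed.

Lemma integral_grid_cells D (g : 'rV[R]_d -> \bar R) :
  measurable D -> D `<=` \bigcup_j A j -> measurable_fun D g ->
  (forall z, D z -> 0 <= g z)%E ->
  (\int[lebesgue_rV R d]_(z in D) g z =
   \sum_(j < m) \int[lebesgue_rV R d]_(z in A j `&` D) g z)%E.
Proof.
move=> mD DA mg g0; have [_ _ _ tA _] := A_part.
have DE : D = \big[setU/set0]_(j < m) (A j `&` D).
  rewrite -bigcup_ordE -setI_bigcupl; apply/esym/setIidr.
  exact: DA.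
rewrite {1}DE ge0_integral_bigsetU//=; rewrite -?DE//.
- by move=> j; apply: measurableI => //; exact: measurable_grid_cell.
- exact: index_enum_uniq.
- by move=> i j _ _ [z [[Ai _] [Aj _]]]; apply: tA => //; exists z.
Qed.

Lemma sum_cond_prob x : X x ->
  \sum_(j < m) cond_prob f (A j) x + cond_prob f A0 x = 1.
Proof.
move=> Xx; apply: EFin_inj; rewrite EFinD -sumEFin -(intf Xx).
have f0Y y : Y y -> (0 <= (f y x)%:E)%E by move=> Yy; rewrite lee_fin f0.
have cellsY : \bigcup_j A j `<=` Y by rewrite grid_cellsE => y [].
rewrite cond_probE//; [|exact: measurable_grid_rest|exact: grid_rest_sub].
have mcells : measurable (\bigcup_j A j).
  by rewrite grid_cellsE; apply: measurableD => //; exact: measurable_grid_rest.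
have -> : (\sum_(j < m) (cond_prob f (A j) x)%:E =
    \int[lebesgue_rV R d]_(y in \bigcup_j A j) (f y x)%:E)%E.
  rewrite integral_grid_cells//; last 2 first.
  - exact: measurable_sectionE.
  - by move=> y /cellsY; exact: f0Y.
  apply: eq_bigr => j _.
  rewrite cond_probE//; [|exact: measurable_grid_cell|exact: grid_cell_sub].
  by congr (integral _ _ _); apply/esym/setIidl => y Ay; exists j.
have YE : Y = \bigcup_j A j `|` A0.
  by rewrite grid_cellsE setDKU//; exact: grid_rest_sub.
rewrite [in RHS]YE ge0_integral_setU//=; rewrite -?YE//.
- exact: measurable_grid_rest.
- exact: measurable_sectionE.
- by move=> y [/cellsY|/grid_rest_sub]; exact: f0Y.
- by rewrite grid_cellsE disj_set2E setDKI.
Qed.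

Variables (sigma sigma0 : R).
Hypotheses (sigma_gt0 : 0 < sigma) (sigma0_gt0 : 0 < sigma0).

(** The component of the model attached to the cell of X with center t, a
    probability density in y. *)
Definition grid_mixture (t : 'rV[R]_dx) (y : 'rV[R]_d) : R :=
  \sum_(j < m) cond_prob f (A j) t * normal_density y (mu j) sigma
  + cond_prob f A0 t * normal_density y 0 sigma0.

Lemma grid_mixture_ge0 t y : X t -> 0 <= grid_mixture t y.
Proof.
move=> Xt; rewrite addr_ge0// ?sumr_ge0// => *.
by rewrite mulr_ge0 ?cond_prob_ge0 ?ltW ?normal_density_gt0//; exact: grid_cell_sub.
by rewrite mulr_ge0 ?cond_prob_ge0 ?ltW ?normal_density_gt0//; exact: grid_rest_sub.
Qed.

Lemma grid_mixture_gt0 t y : X t -> 0 < grid_mixture t y.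
Proof.
move=> Xt; rewrite lt_neqAle grid_mixture_ge0// andbT; apply/eqP => g0.
have Ag0 j : 0 <= cond_prob f (A j) t * normal_density y (mu j) sigma.
  by rewrite mulr_ge0 ?cond_prob_ge0 ?ltW ?normal_density_gt0//; exact: grid_cell_sub.
have A0g0 : 0 <= cond_prob f A0 t * normal_density y 0 sigma0.
  by rewrite mulr_ge0 ?cond_prob_ge0 ?ltW ?normal_density_gt0//; exact: grid_rest_sub.
have := esym g0; move/eqP; rewrite paddr_eq0 ?sumr_ge0// => /andP[].
rewrite psumr_eq0// => /allP Aeq.
rewrite mulf_eq0 (gt_eqF (normal_density_gt0 _ _ sigma0_gt0)) orbF => /eqP A0eq.
have := sum_cond_prob Xt; rewrite A0eq addr0 big1 => [/eqP|j _].
  by rewrite eq_sym oner_eq0.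
have := Aeq j (mem_index_enum _); rewrite mulf_eq0.
by rewrite (gt_eqF (normal_density_gt0 _ _ sigma_gt0)) orbF => /eqP.
Qed.

Lemma measurable_grid_mixture t : measurable_fun setT (grid_mixture t).
Proof.
apply: measurable_funD.
  by apply: measurable_sum => j; apply: measurable_funM => //;
    exact: measurable_normal_density.
by apply: measurable_funM => //; exact: measurable_normal_density.
Qed.

Lemma integral_grid_mixture t : X t ->
  (\int[lebesgue_rV R d]_y (grid_mixture t y)%:E = 1)%E.
Proof.
move=> Xt; rewrite -(sum_cond_prob Xt).
have mnd c u : measurable_fun setT (fun y : 'rV[R]_d => (normal_density y c u)%:E).
  by apply/measurable_EFinP; exact: measurable_normal_density.
have nd0 c u y : 0 < u -> (0 <= (@normal_density R d y c u)%:E)%E.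
  by move=> u0; rewrite lee_fin ltW// normal_density_gt0.
have cA j : 0 <= cond_prob f (A j) t.
  by apply: cond_prob_ge0 => //; exact: grid_cell_sub.
have cA0 : 0 <= cond_prob f A0 t.
  by apply: cond_prob_ge0 => //; exact: grid_rest_sub.
under eq_integral.
  move=> y _; rewrite EFinD -sumEFin EFinM.
  under eq_bigr do rewrite EFinM.
  over.
rewrite ge0_integralD//; last 4 first.
- move=> y _; apply: sume_ge0 => j _.
  by apply: mule_ge0; [rewrite lee_fin|exact: nd0].
- by apply: emeasurable_sum => j; exact: measurable_funeM.
- by move=> y _; apply: mule_ge0; [rewrite lee_fin|exact: nd0].
- exact: measurable_funeM.
rewrite ge0_integral_sum//; last 2 first.
- by move=> j; exact: measurable_funeM.
- by move=> j y _; apply: mule_ge0; [rewrite lee_fin|exact: nd0].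
rewrite EFinD -sumEFin; congr (_ + _)%E.
  apply: eq_bigr => j _; rewrite ge0_integralZl//; last 2 first.
  - by move=> y _; exact: nd0.
  - by rewrite lee_fin.
  by rewrite integral_normal_density// mule1.
rewrite ge0_integralZl//; last by move=> y _; exact: nd0.
by rewrite integral_normal_density// mule1.
Qed.

Lemma grid_mixture_ge_rest t y D (l v : R) : X t -> measurable D -> D `<=` A0 ->
  0 <= l -> (forall z, D z -> l <= f z t) -> lebesgue_rV R d D = v%:E ->
  l * v * normal_density y 0 sigma0 <= grid_mixture t y.
Proof.
move=> Xt mD DA0 l0 lf Dv; rewrite /grid_mixture ler_wpDl//.
  apply: sumr_ge0 => j _; rewrite mulr_ge0//; last first.
    by rewrite ltW// normal_density_gt0.
  by rewrite cond_prob_ge0//; exact: grid_cell_sub.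
rewrite ler_wpM2r//; first by rewrite ltW// normal_density_gt0.
apply: (cond_prob_ge _ mD) => //; first exact: measurable_grid_rest.
exact: grid_rest_sub.
Qed.

(** The basic lower bound: shrink each A j to its trace on D, where the density
    is at least l, and bring the normal density, constant in z, under the
    integral over the trace, where it is at least g z. *)
Lemma grid_mixture_ge_cells t y D (g : 'rV[R]_d -> R) (l : R) :
  X t -> measurable D -> D `<=` \bigcup_j A j ->
  measurable_fun D g -> (forall z, D z -> 0 <= g z) ->
  (forall j z, A j z -> D z -> g z <= normal_density y (mu j) sigma) ->
  0 <= l -> (forall z, D z -> l <= f z t) ->
  (l%:E * \int[lebesgue_rV R d]_(z in D) (g z)%:E <= (grid_mixture t y)%:E)%E.
Proof.
move=> Xt mD DA mg g0 gnd l0 lf.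
have mg' : measurable_fun D (EFin \o g) by exact/measurable_EFinP.
apply: (@le_trans _ _ (\sum_(j < m) (cond_prob f (A j) t *
    normal_density y (mu j) sigma))%:E); last first.
  rewrite lee_fin lerDl mulr_ge0 ?cond_prob_ge0//; first exact: grid_rest_sub.
  by rewrite ltW// normal_density_gt0.
rewrite integral_grid_cells//.
rewrite -sumEFin ge0_sume_distrr; last first.
  by move=> j _; apply: integral_ge0 => z [_ Dz]; rewrite lee_fin g0.
apply: lee_sum => j _; have mA := measurable_grid_cell j.
have mAD : measurable (A j `&` D) by exact: measurableI.
rewrite -ge0_integralZl//; last 2 first.
- by apply: measurable_funS mg' => // z [].
- by move=> z [_ Dz]; rewrite lee_fin g0.
set c := normal_density y (mu j) sigma.
have c0 : 0 <= c by rewrite ltW// normal_density_gt0.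
rewrite mulrC EFinM cond_probE//; last exact: grid_cell_sub.
have mfA : measurable_fun (A j) (fun z => (f z t)%:E).
  by apply: measurable_sectionE => //; exact: grid_cell_sub.
rewrite -ge0_integralZl//; last first.
  by move=> z /grid_cell_sub Yz; rewrite lee_fin f0.
apply: (@le_trans _ _
    (\int[lebesgue_rV R d]_(z in A j `&` D) (c%:E * (f z t)%:E))%E).
  apply: ge0_le_integral => //.
  - by move=> z [_ Dz]; rewrite -EFinM lee_fin mulr_ge0// g0.
  - by apply: measurable_funeM; apply: measurable_funS mg' => // z [].
  - by apply: measurable_funeM; apply: measurable_funS mfA => // z [].
  - move=> z [Az Dz]; rewrite -!EFinM lee_fin mulrC ler_pM// ?g0 ?gnd ?lf//.
apply: ge0_subset_integral => //; first exact: measurable_funeM.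
by move=> z /grid_cell_sub Yz; rewrite -EFinM lee_fin mulr_ge0 ?f0.
Qed.


(** Only the subcube of side sigma at the vertex y is used: the cells that meet
    it have their centers within 3 / 2 sigma of y in each coordinate, so their
    normal densities at y are at least a constant times sigma^(- d), the inverse
    of the volume of the subcube. *)
Lemma grid_mixture_ge_corner t y (a : R) C (l : R) : X t ->
  0 <= h <= sigma -> sigma <= a ->
  is_hypercube_with_vertex a y C -> C `<=` \bigcup_j A j ->
  0 <= l -> (forall z, C z -> l <= f z t) ->
  l * ((2 * pi) `^ (- (d%:R / 2)) * expR (- (d%:R * (9 / 8))))
    <= grid_mixture t y.
Proof.
move=> Xt /andP[h0 hs] sa [c [CE yc]] CA l0 lf.
have a0 : 0 < a by exact: lt_le_trans sa.
pose k := sigma / a; have ka : k * a = sigma by rewrite divfK// gt_eqF.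
have k0 : 0 < k by rewrite divr_gt0.
have k1 : k <= 1 by rewrite ler_pdivrMr// mul1r.
(* The center of the subcube of C of side sigma with the same vertex y. *)
pose c' : 'rV[R]_d := \row_i (y ord0 i + (c ord0 i - y ord0 i) * k).
pose D := cube c' sigma.
have cy i : `|c ord0 i - y ord0 i| = a / 2 by rewrite distrC yc.
have Dy z : D z -> forall i, `|y ord0 i - z ord0 i| <= sigma.
  move=> Dz i; have := Dz i; rewrite mxE => zc.
  rewrite distrC (_ : z ord0 i - y ord0 i = z ord0 i -
    (y ord0 i + (c ord0 i - y ord0 i) * k) + (c ord0 i - y ord0 i) * k); last by ring.
  apply: (le_trans (ler_normD _ _)); rewrite normrM cy (gtr0_norm k0).
  have -> : a / 2 * k = sigma / 2 by rewrite -ka; ring.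
  by lra.
have DC : D `<=` C.
  move=> z Dz; rewrite CE => i; have := Dz i; rewrite mxE => zc.
  rewrite (_ : z ord0 i - c ord0 i = z ord0 i -
    (y ord0 i + (c ord0 i - y ord0 i) * k) - (c ord0 i - y ord0 i) * (1 - k)); last by ring.
  apply: (le_trans (ler_normB _ _)); rewrite normrM cy (ger0_norm (_ : 0 <= 1 - k)); last by lra.
  have -> : a / 2 * (1 - k) = a / 2 - sigma / 2 by rewrite -ka; ring.
  by lra.
pose g := (2 * pi * sigma ^+ 2) `^ (- (d%:R / 2)) * expR (- (d%:R * (9 / 8))).
have g0 : 0 <= g by rewrite mulr_ge0 ?powR_ge0 ?expR_ge0.
have [AE _ _ _ _] := A_part.
have mD : measurable D by exact: measurable_cube.
have := @grid_mixture_ge_cells t y D (cst g) l Xt mD (subset_trans DC CA).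
have gnd j z : A j z -> D z -> g <= normal_density y (mu j) sigma.
  rewrite AE => Az Dz; apply: normal_density_ge => // i.
  have := Dy z Dz i; have := Az i => /andP[z1 z2].
  rewrite !ler_norml => /andP[z3 z4]; apply/andP; split; lra.
move=> /(_ (measurable_cst _) (fun _ _ => g0) gnd l0 (fun z Dz => lf z (DC z Dz))).
have lD : lebesgue_rV R d D = (sigma ^+ d)%:E by exact/lebesgue_rV_cube/ltW.
have -> : (\int[lebesgue_rV R d]_(z in D) (cst g z)%:E = (g * sigma ^+ d)%:E)%E.
  by rewrite (integral_cst (lebesgue_rV R d) mD g%:E) [RHS]EFinM; congr (_ * _)%E.
rewrite -EFinM lee_fin.
suff -> : g * sigma ^+ d = (2 * pi) `^ (- (d%:R / 2)) * expR (- (d%:R * (9 / 8))) by [].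
rewrite /g mulrAC; congr (_ * _).
rewrite powRM ?sqr_ge0 ?mulr_ge0 ?pi_ge0//.
rewrite -[sigma ^+ 2]powR_mulrn ?(ltW sigma_gt0)// -powRrM.
rewrite -[sigma ^+ d]powR_mulrn ?(ltW sigma_gt0)// -mulrA -powRD; last first.
  by rewrite (gt_eqF sigma_gt0) implybT.
by rewrite (_ : 2%:R * - (d%:R / 2) + d%:R = 0) ?powRr0 ?mulr1//; field.
Qed.

Lemma grid_mixture_ge_local t y (K l : R) : X t -> 0 <= h -> 0 <= K ->
  cube y (2 * (K * sigma)) `<=` \bigcup_j A j ->
  0 <= l -> (forall z, cube y (2 * (K * sigma)) z -> l <= f z t) ->
  l * (expR (- (d%:R * (K * (h / sigma) / 2 + (h / sigma) ^+ 2 / 8))) *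
       (1 - 2 `^ (d%:R / 2) * expR (- (K ^+ 2 / 4)))) <= grid_mixture t y.
Proof.
move=> Xt h0 K0 DA l0 lf; set D := cube _ _ in DA lf *.
set th := expR _; have th0 : 0 <= th by exact: expR_ge0.
have mD : measurable D by exact: measurable_cube.
have mnd : measurable_fun D (fun z => normal_density z y sigma).
  by apply: measurable_funTS; exact: measurable_normal_density.
have nd0 z : 0 <= normal_density z y sigma by rewrite ltW// normal_density_gt0.
have [AE _ _ _ _] := A_part.
have := @grid_mixture_ge_cells t y D (fun z => th * normal_density z y sigma) l Xt mD DA.
have mg : measurable_fun D (fun z => th * normal_density z y sigma).
  exact: measurable_funM.
have g0 z : D z -> 0 <= th * normal_density z y sigma by rewrite mulr_ge0.
have gnd j z : A j z -> D z ->
    th * normal_density z y sigma <= normal_density y (mu j) sigma.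
  rewrite AE => Az Dz; rewrite normal_densityC.
  apply: normal_density_shift_ge => // i.
    by have := Dz i; rewrite (_ : 2 * (K * sigma) / 2 = K * sigma)//; field.
  have /andP[z1 z2] := Az i; rewrite ler_norml; apply/andP; split; lra.
move=> /(_ mg g0 gnd l0 lf); rewrite -lee_fin; apply: le_trans.
rewrite EFinM lee_wpmul2l ?lee_fin//.
under eq_integral do rewrite EFinM.
rewrite ge0_integralZl//; last 2 first.
- exact/measurable_EFinP.
- by move=> z _; rewrite lee_fin.
by rewrite EFinM lee_wpmul2l ?lee_fin//; exact: integral_normal_density_cube_ge.
Qed.

Variables (N : nat) (xc : 'I_N -> 'rV[R]_dx) (Rm : R).
Hypotheses (N_gt0 : (0 < N)%N) (Xxc : forall i, X (xc i)).

Let p := model3 f Rm sigma sigma0 A0 A mu xc.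

Lemma model3E y x :
  p y x = \sum_(i < N) logit_weight Rm xc i x * grid_mixture (xc i) y.
Proof.
apply: eq_bigr => i _; rewrite mulrDr mulr_sumr; congr (_ + _).
  by apply: eq_bigr => j _; rewrite /mixing_prob; ring.
by rewrite /mixing_prob; ring.
Qed.

Lemma model3_ge (Q : pred 'I_N) y x (v : R) :
  (forall i, Q i -> v <= grid_mixture (xc i) y) ->
  (\sum_(i < N | Q i) logit_weight Rm xc i x) * v <= p y x.
Proof.
move=> vg; rewrite model3E mulr_suml [leRHS](bigID Q)/= ler_wpDr//.
  by apply: sumr_ge0 => i _; rewrite mulr_ge0 ?grid_mixture_ge0// ltW// logit_weight_gt0.
by apply: ler_sum => i Qi; rewrite ler_wpM2l ?vg// ltW// logit_weight_gt0.
Qed.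

Lemma model3_gt0 y x : 0 < p y x.
Proof.
rewrite model3E (bigD1 (Ordinal N_gt0))//= ltr_pwDl//.
  by rewrite mulr_gt0 ?logit_weight_gt0 ?grid_mixture_gt0.
by apply: sumr_ge0 => i _; rewrite mulr_ge0 ?grid_mixture_ge0// ltW// logit_weight_gt0.
Qed.

Lemma measurable_model3 : measurable_fun setT (fun z => p z.1 z.2).
Proof.
under eq_fun do rewrite model3E.
apply: measurable_sum => i; apply: measurable_funM.
  apply: (measurable_comp (F := setT)) => //.
  exact: measurable_logit_weight.
by apply: (measurable_comp (F := setT)) => //; exact: measurable_grid_mixture.
Qed.

(** An inequality only, because the normal components may charge the complement
    of Y. *)
Lemma integral_model3_le (rho : probability 'rV[R]_dx R) :
  (\int[lebesgue_rV R d \x rho]_(z in Y `*` X) (p z.1 z.2)%:E <= 1)%E.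
Proof.
have p0 z : (0 <= (p z.1 z.2)%:E)%E by rewrite lee_fin ltW// model3_gt0.
have mp : measurable_fun setT (fun z => (p z.1 z.2)%:E).
  apply/measurable_EFinP; exact: measurable_model3.
have [mpY ->] := ge0_integral_setX (lebesgue_rV R d) rho mY mX mp p0.
apply: (@le_trans _ _ (\int[rho]_(x in X) 1)%E); last first.
  by rewrite integral_cst// mul1e; exact: probability_le1.
apply: ge0_le_integral => //.
- by move=> x _; apply: integral_ge0 => y _; exact: p0.
- exact: measurable_funTS.
move=> x Xx /=.
have mpx : measurable_fun setT (fun y => (p y x)%:E).
  apply/measurable_EFinP; under eq_fun do rewrite model3E.
  apply: measurable_sum => i; apply: measurable_funM => //.
  exact: measurable_grid_mixture.
have px0 y : (0 <= (p y x)%:E)%E by rewrite lee_fin ltW// model3_gt0.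
apply: (@le_trans _ _ (\int[lebesgue_rV R d]_y (p y x)%:E)%E).
  exact: ge0_subset_integral.
have mgm i : measurable_fun setT (fun y => (grid_mixture (xc i) y)%:E).
  by apply/measurable_EFinP; exact: measurable_grid_mixture.
have gm0 i y : (0 <= (grid_mixture (xc i) y)%:E)%E.
  by rewrite lee_fin grid_mixture_ge0.
have w0 i : (0 <= (logit_weight Rm xc i x)%:E)%E.
  by rewrite lee_fin ltW// logit_weight_gt0.
under eq_integral.
  move=> y _; rewrite model3E -sumEFin.
  under eq_bigr do rewrite EFinM.
  over.
rewrite ge0_integral_sum//; last 2 first.
- by move=> i; exact: measurable_funeM.
- by move=> i y _; exact: mule_ge0.
rewrite -[leRHS](congr1 EFin (sum_logit_weight xc Rm x N_gt0)) -sumEFin.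
apply: lee_sum => i _; rewrite ge0_integralZl//.
by rewrite integral_grid_mixture// mule1.
Qed.


(** The bound behind domination.  The distant cells of X are dropped at the cost
    of a factor 1 / 2, and the local infimum bounds f at all the remaining
    centers.  K0 absorbs the constants of the two cases, so that one function of
    y serves both. *)
Lemma model3_ge_local_inf (s r l K0 : R) y x (C : set 'rV[R]_d) :
  Y y -> 0 < r -> 0 <= h <= sigma -> sigma <= r / 2 -> 2 * s <= r ^+ 2 ->
  2^-1 <= \sum_(i < N | sqdist (xc i) x <= 2 * s) logit_weight Rm xc i x ->
  (A0 y -> exists D, is_hypercube_with_vertex (r / 2) y D /\
    D `<=` C `&` A0) ->
  ((Y `\` A0) y -> exists D, is_hypercube_with_vertex (r / 2) y D /\
    D `<=` C `&` (Y `\` A0)) ->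
  expR (- K0) <=
    2^-1 * ((r / 2) ^+ d * (2 * pi * sigma0 ^+ 2) `^ (- (d%:R / 2))) ->
  expR (- K0) <=
    2^-1 * ((2 * pi) `^ (- (d%:R / 2)) * expR (- (d%:R * (9 / 8)))) ->
  0 <= l -> (l%:E <= local_inf f X r (C `&` Y) x)%E ->
  l * expR (- (K0 + sqdist y 0 / (2 * sigma0 ^+ 2))) <= p y x.
Proof.
move=> Yy r0 hs sr s2 near2 C0 C1 K1 K2 l0 linf.
have q0 : 0 <= sqdist y 0 / (2 * sigma0 ^+ 2).
  by rewrite divr_ge0 ?sqdist_ge0// mulr_ge0 ?sqr_ge0.
have lf i z : sqdist (xc i) x <= 2 * s -> C z -> Y z -> l <= f z (xc i).
  move=> xi Cz Yz; rewrite -lee_fin; apply: (le_trans linf).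
  apply: ereal_inf_lbound; exists (z, xc i) => //=; split => //=; split => //.
  rewrite /enorm dotvBE -[leRHS](ger0_norm (ltW r0)) -sqrtr_sqr.
  by apply: ler_wsqrtr; exact: le_trans s2.
have pge v : 0 <= v -> (forall i, sqdist (xc i) x <= 2 * s ->
    v <= grid_mixture (xc i) y) -> 2^-1 * v <= p y x.
  move=> v0 vg; apply: le_trans
    (@model3_ge (fun i => sqdist (xc i) x <= 2 * s) y x v vg).
  by rewrite ler_wpM2r.
have [A0y|nA0y] := pselect (A0 y).
  have [D [[c [DE _]] DC]] := C0 A0y.
  have r2 : 0 <= r / 2 by rewrite divr_ge0// ltW.
  have mD : measurable D by rewrite DE; exact: measurable_cube.
  have lD : lebesgue_rV R d D = ((r / 2) ^+ d)%:E.
    by rewrite DE; exact: lebesgue_rV_cube.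
  have nd0 : 0 <= normal_density y 0 sigma0 by rewrite ltW// normal_density_gt0.
  have := pge _ (mulr_ge0 (mulr_ge0 l0 (exprn_ge0 d r2)) nd0)
    (fun i xi => @grid_mixture_ge_rest (xc i) y D l _ (Xxc i) mD
      (fun z Dz => (DC z Dz).2) l0
      (fun z Dz => lf i z xi (DC z Dz).1 (grid_rest_sub (DC z Dz).2)) lD).
  apply: le_trans; rewrite normal_densityE opprD expRD.
  rewrite [leRHS](_ : _ = l * ((2^-1 * ((r / 2) ^+ d *
    (2 * pi * sigma0 ^+ 2) `^ (- (d%:R / 2)))) *
    expR (- (sqdist y 0 / (2 * sigma0 ^+ 2))))); last by ring.
  by rewrite ler_wpM2l// ler_wpM2r ?expR_ge0.
have [D [Dv DC]] := C1 (conj Yy nA0y).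
have DA : D `<=` \bigcup_j A j by rewrite grid_cellsE => z /DC[].
set c := (X in 2^-1 * X) in K2; have c0 : 0 <= c.
  by rewrite mulr_ge0 ?powR_ge0 ?expR_ge0.
have := pge _ (mulr_ge0 l0 c0)
  (fun i xi => @grid_mixture_ge_corner (xc i) y (r / 2) D l
    (Xxc i) hs sr Dv DA l0 (fun z Dz => lf i z xi (DC z Dz).1 (DC z Dz).2.1)).
apply: le_trans.
rewrite [leRHS]mulrCA ler_wpM2l// opprD expRD -[leRHS]mulr1 ler_pM ?expR_ge0//.
by rewrite expR_le1 oppr_le0.
Qed.

Lemma model3_ge_cube (s W l K : R) y x :
  0 <= h -> 0 <= K -> 0 <= W -> 0 <= l ->
  2 `^ (d%:R / 2) * expR (- (K ^+ 2 / 4)) <= 1 ->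
  W <= \sum_(i < N | sqdist (xc i) x <= 2 * s) logit_weight Rm xc i x ->
  cube y (2 * (K * sigma)) `<=` Y `\` A0 ->
  (forall i z, sqdist (xc i) x <= 2 * s -> cube y (2 * (K * sigma)) z ->
    l <= f z (xc i)) ->
  W * (l * (expR (- (d%:R * (K * (h / sigma) / 2 + (h / sigma) ^+ 2 / 8))) *
       (1 - 2 `^ (d%:R / 2) * expR (- (K ^+ 2 / 4))))) <= p y x.
Proof.
move=> h0 K0 W0 l0 K1 WQ cA lf.
apply: le_trans (@model3_ge (fun i => sqdist (xc i) x <= 2 * s) y x _ _).
  by apply: (ler_wpM2r _ WQ); rewrite !mulr_ge0 ?expR_ge0 ?subr_ge0.
move=> i xi; apply: grid_mixture_ge_local => //; first by rewrite grid_cellsE.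
by move=> z cz; exact: lf.
Qed.

End mixture.

(** * Log-ratios and limits *)

Section pos_log_ratio.
Variable R : realType.
Local Open Scope ereal_scope.

Lemma pos_log_ratio_le (f p e : R) : (0 < p)%R -> (0 <= e)%R ->
  (f * expR (- e) <= p)%R -> maxe (lne (f%:E / p%:E)) 0 <= e%:E.
Proof.
move=> p0 e0 fep; rewrite ge_max lee_fin e0 andbT inver gt_eqF// -EFinM.
have [fp|fp] := leP (f / p)%R 0%R.
  by rewrite le0_lneNy ?lee_fin// leNye.
rewrite lne_EFin// lee_fin -ler_expR lnK// ler_pdivrMr//.
by rewrite -ler_pdivrMl ?expR_gt0// -expRN mulrC.
Qed.

(** The case i = 0 is trivial since the quotient is then +oo; if f = 0 the
    left-hand side vanishes. *)
Lemma pos_log_ratio_envelope (f p H : R) (i : \bar R) :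
  (0 <= f)%R -> (0 < p)%R -> (0 <= H)%R -> 0 <= i -> i <= f%:E ->
  (forall l, (0 <= l)%R -> l%:E <= i -> (l * expR (- H) <= p)%R) ->
  maxe (lne (f%:E / p%:E)) 0 <= maxe (lne (f%:E / i)) 0 + H%:E.
Proof.
move=> f0 p0 H0; case: i => [l| |]//; rewrite !lee_fin => l0 lf lp.
have RHS0 : 0 <= maxe (lne (f%:E / l%:E)) 0 + H%:E.
  by rewrite adde_ge0 ?lee_fin// le_max lexx orbT.
have [fE|fgt] := eqVneq f 0%R.
  apply: le_trans RHS0; rewrite (_ : 0 = (0 : R)%:E)//.
  by apply: pos_log_ratio_le => //; rewrite fE mul0r ltW.
have {f0 fgt} f0 : (0 < f)%R by rewrite lt_neqAle eq_sym fgt.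
have [lE|lgt] := eqVneq l 0%R.
  rewrite lE [X in _ <= maxe (lne (_ * X)) _ + _]inver eqxx gt0_muley ?lte_fin//.
  by rewrite /= [X in _ <= X + _]max_l ?leey// addye ?leey.
have {l0 lgt} l0 : (0 < l)%R by rewrite lt_neqAle eq_sym lgt.
have fl : (1 <= f / l)%R by rewrite ler_pdivlMr ?mul1r.
have lnfl : (0 <= ln (f / l))%R by exact: ln_ge0.
rewrite [X in _ <= maxe (lne (_ * X)) _ + _]inver gt_eqF// -[f%:E * (l^-1)%:E]EFinM.
rewrite lne_EFin ?divr_gt0// [X in _ <= X + _]max_l ?lee_fin// -EFinD.
apply: pos_log_ratio_le => //; first exact: addr_ge0.
rewrite opprD expRD expRN lnK ?posrE ?divr_gt0// mulrA invf_div.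
rewrite (_ : f * (l / f) = l)%R; last by rewrite mulrC divfK// gt_eqF.
by apply: lp; [exact: ltW|rewrite lexx].
Qed.

Lemma ratio_ge1 (f : R) (i : \bar R) : (0 < f)%R -> 0 <= i -> i <= f%:E ->
  1 <= f%:E / i.
Proof.
move=> f0; case: i => [l| |]//; rewrite !lee_fin => l0 lf.
have [->|lgt] := eqVneq l 0%R; first by rewrite inver eqxx gt0_muley ?lte_fin// leey.
rewrite inver (negbTE lgt) -EFinM lee_fin ler_pdivlMr ?mul1r//.
by rewrite lt_neqAle eq_sym lgt.
Qed.

End pos_log_ratio.

Section limits.
Variable R : realType.
Implicit Types (h delta sigma : nat -> R).

Lemma cvg_sigma0 delta sigma : (forall m, 0 < delta m) ->
  delta m @[m --> \oo] --> 0 -> sigma m / delta m @[m --> \oo] --> 0 ->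
  sigma m @[m --> \oo] --> 0.
Proof.
move=> d0 dcv sdcv.
rewrite (_ : sigma = (fun m => sigma m / delta m * delta m)); last first.
  by apply/funext => m; rewrite divfK// gt_eqF.
by rewrite -[X in _ --> X](mulr0 (0 : R)); exact: cvgM.
Qed.

(** h / sigma = (delta^(d - 1) h / sigma^d) (sigma / delta)^(d - 1), and the
    second factor is bounded. *)
Lemma cvg_h_sigma0 (d : nat) h delta sigma : (0 < d)%N ->
  (forall m, 0 < delta m) -> (forall m, 0 < sigma m) ->
  sigma m / delta m @[m --> \oo] --> 0 ->
  delta m ^+ d.-1 * h m / sigma m ^+ d @[m --> \oo] --> 0 ->
  h m / sigma m @[m --> \oo] --> 0.
Proof.
case: d => // d _ d0 s0 sdcv dhscv.
rewrite (_ : (fun m => h m / sigma m) = (fun m =>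
    delta m ^+ d * h m / sigma m ^+ d.+1 * (sigma m / delta m) ^+ d)); last first.
  apply/funext => m; have dm := lt0r_neq0 (d0 m); have sm := lt0r_neq0 (s0 m).
  rewrite exprS expr_div_n; field; by rewrite !expf_neq0.
rewrite -[X in _ --> X](mul0r ((0 : R) ^+ d)); apply: cvgM => //.
apply: (cvg_comp (fun m => sigma m / delta m) (fun u : R => u ^+ d) sdcv).
exact: exprn_continuous.
Qed.

Lemma gaussian_cutoff (c e : R) : 0 < c -> 0 < e ->
  exists2 K, 0 <= K & expR (- e) <= 1 - c * expR (- (K ^+ 2 / 4)).
Proof.
move=> c0 e0; pose eta := 1 - expR (- e).
have eta0 : 0 < eta by rewrite subr_gt0 expR_lt1 oppr_lt0.
pose a := `|ln (c / eta)|; exists (2 * (1 + a)).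
  by rewrite mulr_ge0// addr_ge0// normr_ge0.
suff : c * expR (- ((2 * (1 + a)) ^+ 2 / 4)) <= eta by rewrite /eta; lra.
rewrite -ler_pdivlMl// [leRHS]mulrC -[leRHS]lnK ?posrE ?divr_gt0// ler_expR.
rewrite -[eta / c]invf_div lnV ?posrE ?divr_gt0// lerN2.
apply: (le_trans (ler_norm _)); rewrite -/a.
have -> : (2 * (1 + a)) ^+ 2 / 4 = (1 + a) ^+ 2 by field.
have a0 : 0 <= a by exact: normr_ge0.
by rewrite expr2; nra.
Qed.

Lemma near_shift_exponent_le (c K e : R) (u : nat -> R) :
  0 <= c -> 0 <= K -> 0 < e -> (forall m, 0 <= u m) ->
  u m @[m --> \oo] --> 0 ->
  \forall m \near \oo, expR (- e) <= expR (- (c * (K * u m / 2 + u m ^+ 2 / 8))).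
Proof.
move=> c0 K0 e0 u0 ucv.
have k0 : 0 < c * (K / 2 + 1 / 8) + 1.
  by rewrite ltr_wpDl// mulr_ge0// addr_ge0// divr_ge0.
near=> m; rewrite ler_expR lerN2.
have um1 : u m <= 1.
  near: m; exact: (cvgr_le _ ucv).
have ume : u m <= e / (c * (K / 2 + 1 / 8) + 1).
  near: m; apply: (cvgr_le _ ucv); exact: divr_gt0.
have um := u0 m.
rewrite ler_pdivlMr// in ume.
have u2 : u m ^+ 2 <= u m by rewrite expr2; nra.
have w : K * u m / 2 + u m ^+ 2 / 8 <= u m * (K / 2 + 1 / 8) by lra.
apply: (le_trans (ler_wpM2l c0 w)); apply: le_trans ume.
by rewrite mulrCA [leRHS]mulrDr mulr1 lerDl.
Unshelve. all: by end_near. Qed.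

End limits.

Lemma within_continuous_box_gt (R : realType) (d dx : nat)
    (f : 'rV[R]_d -> 'rV[R]_dx -> R) (D : set ('rV[R]_d * 'rV[R]_dx))
    (z : 'rV[R]_d * 'rV[R]_dx) (l : R) :
  f w.1 w.2 @[w --> within D (nbhs z)] --> f z.1 z.2 -> l < f z.1 z.2 ->
  exists2 e, 0 < e & forall w, D w ->
    (forall i, `|w.1 ord0 i - z.1 ord0 i| < e) ->
    (forall i, `|w.2 ord0 i - z.2 ord0 i| < e) -> l < f w.1 w.2.
Proof.
move=> fcv lf; have : \forall w \near within D (nbhs z), l < f w.1 w.2.
  exact: (cvgr_gt _ fcv _ lf).
move=> /nbhs_ballP[e /= e0 H]; exists e => // w Dw w1 w2.
by apply: H => //; split; split => // i j; rewrite (ord1 i) /ball/= distrC.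
Qed.

Lemma expRN_le_pair (R : realType) (a b : R) : 0 < a -> 0 < b ->
  exists2 K, 0 <= K & expR (- K) <= a /\ expR (- K) <= b.
Proof.
move=> a0 b0; exists (`|ln a| + `|ln b|); first by rewrite addr_ge0.
have na := ler_norm (- ln a); have nb := ler_norm (- ln b).
rewrite !normrN in na nb; have na0 := normr_ge0 (ln a).
have nb0 := normr_ge0 (ln b).
by split; [rewrite -[leRHS](lnK a0)|rewrite -[leRHS](lnK b0)]; rewrite ler_expR; lra.
Qed.

Lemma ge0_cvge0P (R : realType) (u : nat -> \bar R) :
  (forall n, 0 <= u n)%E ->
  (forall e, 0 < e -> \forall n \near \oo, (u n <= e%:E)%E) ->
  u n @[n --> \oo] --> 0%E.
Proof.
move=> u0 ue S [e /= e0 eS].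
have := ue (e / 2) (divr_gt0 e0 (ltr0n _ 2)); apply: filterS => n une.
move: une (u0 n); rewrite /preimage/=; case: (u n) => [v| |]//.
rewrite !lee_fin => ve v0; apply: eS => /=.
by rewrite sub0r normrN ger0_norm//; lra.
Qed.

(** F has a density in y, hence does not charge the sets over a null set of y. *)
Lemma negligible_setX (R : realType) (d dx : nat)
  (F : probability ('rV[R]_d * 'rV[R]_dx)%type R) Y X f nu g S :
  measurable Y -> measurable X -> has_densities F Y X f nu g ->
  measurable S -> lebesgue_rV R d S = 0%E -> F ((Y `&` S) `*` X) = 0%E.
Proof.
move=> mY mX [_ [[f0 mf _] [_ _ FAB]]] mS S0; have mYS := measurableI _ _ mY mS.
rewrite FAB//.
apply: integral0_eq => x Xx; rewrite null_set_integral ?mul0e//.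
  apply/measurable_EFinP.
  by apply: measurable_funS (measurable_section mY mX mf Xx) => // y [].
by apply: (subset_measure0 _ _ _ S0) => //; exact: subIsetr.
Qed.


(** * Convergence of the divergence *)

Theorem proposition4p1 (R : realType) (d dx : nat)
  (d_gt0 : (0 < d)%N) (dx_gt0 : (0 < dx)%N)
  (* the distribution F on Y x X, X = [0,1]^dx, and its densities *)
  (Y : set 'rV[R]_d) (mY : measurable Y)
  (X : set 'rV[R]_dx) (X_def : X = unit_cube dx)
  (F : probability ('rV[R]_d * 'rV[R]_dx)%type R)
  (f : 'rV[R]_d -> 'rV[R]_dx -> R)
  (nu : {measure set 'rV[R]_dx -> \bar R}) (g : 'rV[R]_dx -> R)
  (F_densities : has_densities F Y X f nu g)
  (* the sequences *)
  (h delta sigma Rm : nat -> R) (sigma0 : R)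
  (h_gt0 : forall m, 0 < h m) (delta_gt0 : forall m, 0 < delta m)
  (sigma_gt0 : forall m, 0 < sigma m) (Rm_gt0 : forall m, 0 < Rm m)
  (sigma0_gt0 : 0 < sigma0)
  (* the partitions of Y *)
  (A0 : nat -> set 'rV[R]_d) (A : forall m : nat, 'I_m -> set 'rV[R]_d)
  (mu : forall m : nat, 'I_m -> 'rV[R]_d)
  (A_partition : forall m, cubic_grid_partition Y (h m) (A0 m) (A m) (mu m))
  (* the partitions of X *)
  (N : nat -> nat) (b : nat -> R) (b_gt0 : forall m, 0 < b m)
  (B : forall m : nat, 'I_(N m) -> set 'rV[R]_dx)
  (xc : forall m : nat, 'I_(N m) -> 'rV[R]_dx)
  (B_partition : forall m, unit_cube_partition (b m) (B m) (xc m))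
  (B_size : forall m (i : 'I_(N m)),
    lebesgue_rV R dx (B m i) = ((N m)%:R^-1)%:E)
  (N_cvg : (N m)%:R^-1 @[m --> \oo] --> (0 : R))
  (s : nat -> R)
  (s_def : forall m (i : 'I_(N m)),
    s m = dx%:R * fine (lebesgue_rV R dx (B m i)) `^ (2 / dx%:R))
  (* (a) *)
  (h_cvg : h m @[m --> \oo] --> 0)
  (A0_away : forall y, Y y -> exists M0 : nat, forall m, (M0 <= m)%N ->
    cube y (delta m) `&` A0 m = set0)
  (* (b) *)
  (delta_cvg : delta m @[m --> \oo] --> 0)
  (sigma_delta_cvg : sigma m / delta m @[m --> \oo] --> 0)
  (delta_h_sigma_cvg :
    delta m ^+ d.-1 * h m / sigma m ^+ d @[m --> \oo] --> 0)
  (* (c) *)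
  (f_continuous : {ae F, forall z,
    f w.1 w.2 @[w --> within (Y `*` X) (nbhs z)] --> f z.1 z.2})
  (* (d) *)
  (second_moments : forall i j : 'I_d,
    F.-integrable (Y `*` X) (fun z => (z.1 ord0 i * z.1 ord0 j)%:E))
  (* (e) *)
  (r : R) (r_gt0 : 0 < r) (C : 'rV[R]_d -> 'rV[R]_dx -> set 'rV[R]_d)
  (C_hypercube : forall y x, Y y -> X x ->
    is_hypercube r (C y x) /\ C y x y)
  (log_ratio_integral : (\int[F]_(z in Y `*` X)
    lne ((f z.1 z.2)%:E / local_inf f X r (C z.1 z.2 `&` Y) z.2) < +oo)%E)
  (M : nat) (C0 : nat -> 'rV[R]_d -> 'rV[R]_dx -> set 'rV[R]_d)
  (C0_spec : forall m, (M <= m)%N -> forall y x, X x -> A0 m y ->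
    is_hypercube_with_vertex (r / 2) y (C0 m y x) /\
    C0 m y x `<=` C y x `&` A0 m)
  (C1_spec : forall m, (M <= m)%N -> forall y x, X x -> (Y `\` A0 m) y ->
    exists C1, is_hypercube_with_vertex (r / 2) y C1 /\
      C1 `<=` C y x `&` (Y `\` A0 m))
  (* (f) *)
  (pow_lt1 : 2 ^- d.+1 < 1 :> R)
  (C0_small : forall m, (M <= m)%N -> forall y x, X x -> A0 m y ->
    ((normal_density y 0 sigma0)%:E * lebesgue_rV R d (C0 m y x)
       < (2 ^- d.+1)%:E)%E)
  (* (g) *)
  (Rm_cvg : Rm m @[m --> \oo] --> +oo)
  (expR_s_cvg :
    expR (- (Rm m * s m)) / s m `^ (dx%:R / 2) @[m --> \oo] --> 0)
  (s_cvg : s m @[m --> \oo] --> 0) :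
  d_KL F Y X f (model3 f (Rm m) (sigma m) sigma0 (A0 m) (A m) (mu m) (xc m))
    @[m --> \oo] --> 0%E.
Proof.
subst X; have [FYX [[f0 mf intf] [g0 mg FAB]]] := F_densities.
set X := unit_cube dx in FYX f0 mf intf g0 mg FAB *.
have mX : measurable X by exact: measurable_unit_cube.
have mYX : measurable (Y `*` X) by exact: measurableX.
have [rho Fk] := conditional_density_joint mY mX FYX f0 mf intf g0 mg FAB.
have N_gt0 m : (0 < N m)%N by exact: unit_cube_partition_gt0 (B_partition m).
have Xxc m i : X (xc m i) by exact: unit_cube_center (b_gt0 m) (B_partition m) i.
pose p m := model3 f (Rm m) (sigma m) sigma0 (A0 m) (A m) (mu m) (xc m).
have p_gt0 m y x : 0 < p m y x.
  exact: (model3_gt0 mY mX f0 mf intf (A_partition m)).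
have mp m : measurable_fun (Y `*` X) (fun z => p m z.1 z.2).
  by apply: measurable_funTS; exact: measurable_model3.
have intp m : (\int[lebesgue_rV R d \x rho]_(z in Y `*` X)
    (p m z.1 z.2)%:E <= 1)%E.
  exact: (integral_model3_le mY mX f0 mf intf (A_partition m)).
have local_inf_ge0 y x : X x -> (0 <= local_inf f X r (C y x `&` Y) x)%E.
  move=> Xx; apply: le_ereal_inf_tmp => _ [[z t] /= [[_ Yz] [Xt _]] <-].
  by rewrite lee_fin f0.
have local_inf_le y x : Y y -> X x ->
    (local_inf f X r (C y x `&` Y) x <= (f y x)%:E)%E.
  move=> Yy Xx; apply: ereal_inf_lbound; exists (y, x) => //=.
  have [_ Cy] := C_hypercube y x Yy Xx; do 2 split => //=.
  by rewrite /enorm dotvBE /sqdist big1 ?sqrtr0 ?ltW// => i _; rewrite subrr expr0n.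
have h_sigma : h m / sigma m @[m --> \oo] --> 0.
  exact: cvg_h_sigma0 d_gt0 delta_gt0 sigma_gt0 sigma_delta_cvg delta_h_sigma_cvg.
have sigma_cvg : sigma m @[m --> \oo] --> 0.
  exact: cvg_sigma0 delta_gt0 delta_cvg sigma_delta_cvg.
have [K0 K0_ge0 [K01 K02]] : exists2 K0, 0 <= K0 &
    expR (- K0) <= 2^-1 *
      ((r / 2) ^+ d * (2 * pi * sigma0 ^+ 2) `^ (- (d%:R / 2))) /\
    expR (- K0) <= 2^-1 *
      ((2 * pi) `^ (- (d%:R / 2)) * expR (- (d%:R * (9 / 8)))).
  have pi0 : 0 < (pi : R) by exact: pi_gt0.
  by apply: expRN_le_pair; rewrite !mulr_gt0 ?invr_gt0 ?exprn_gt0 ?powR_gt0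
    ?expR_gt0 ?divr_gt0 ?mulr_gt0 ?exprn_gt0.
pose W m := 1 - dx%:R `^ (dx%:R / 2) * (expR (- (Rm m * s m)) / s m `^ (dx%:R / 2)).
have W_cvg : W m @[m --> \oo] --> (1 : R).
  rewrite -[X in _ --> X](subr0 (1 : R)).
  rewrite -[X in _ --> _ - X](mulr0 (dx%:R `^ (dx%:R / 2))).
  by apply: cvgB; [exact: cvg_cst|apply: cvgM => //; exact: cvg_cst].
have W_le m x : X x -> W m <=
    \sum_(i < N m | sqdist (xc m i) x <= 2 * s m) logit_weight (Rm m) (xc m) i x.
  move=> Xx; exact: (sum_near_logit_weight_ge dx_gt0 (b_gt0 m) (B_partition m)
    (B_size m) (s_def m) (ltW (Rm_gt0 m)) Xx).
pose H (z : 'rV[R]_d * 'rV[R]_dx) := K0 + sqdist z.1 0 / (2 * sigma0 ^+ 2).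
apply: (@cvg_integral_lower_dominated _ _ R F (Y `*` X) _
  (fun z => lne ((f z.1 z.2)%:E / local_inf f X r (C z.1 z.2 `&` Y) z.2)%E) H) => //.
- by move=> m; apply: (measurable_log_ratio mYX mf (mp m)) => z _; exact: p_gt0.
(* Almost every y avoids the lower faces of all cells; such a y is interior to
   any cell that contains it, hence to Y. *)
- have off : {ae F, forall z, forall m (j : 'I_m) (i : 'I_d), (Y `*` X) z ->
      z.1 ord0 i <> mu m j ord0 i - h m / 2}.
    apply: ae_foralln => m; apply: filter_forall => j; apply: filter_forall => i.
    have [mS S0] := lebesgue_rV_hyperplane i (mu m j ord0 i - h m / 2).
    exists ((Y `&` [set v | v ord0 i = mu m j ord0 i - h m / 2]) `*` X); split.
    + by apply: measurableX => //; exact: measurableI.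
    + exact: (negligible_setX mY mX F_densities mS S0).
    + by move=> -[y x] /= /not_implyP[[/= Yy Xx] /contrapT yi].
  apply: filterS2 f_continuous off => -[y x] fcv off [/= Yy Xx].
  apply: ge0_cvge0P => [m|e e0]; first exact: funepos_ge0.
  suff : \forall m \near \oo, f y x * expR (- e) <= p m y x.
    apply: filterS => m fp; rewrite funeposE.
    by apply: pos_log_ratio_le => //; [exact: p_gt0|exact: ltW].
  have := f0 _ _ Yy Xx; rewrite le_eqVlt => /predU1P[<-|fyx].
    by apply: nearW => m; rewrite mul0r ltW.
  have e4 : 0 < e / 4 by rewrite divr_gt0.
  have E4 : 0 < 1 - expR (- (e / 4)) by rewrite subr_gt0 expR_lt1 oppr_lt0.
  pose l := f y x * expR (- (e / 4)).
  have lf : l < f y x by rewrite /l gtr_pMr// expR_lt1 oppr_lt0.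
  have [eps eps0 fbox] := within_continuous_box_gt fcv lf.
  have c0 : 0 < 2 `^ (d%:R / 2) :> R by rewrite powR_gt0.
  have [K K_ge0 EK] := gaussian_cutoff c0 e4.
  have K1 : 0 < K + 1 by rewrite ltr_wpDl.
  (* The cell of y at the single stage m0 certifies that y is interior to Y; the
     cubes of half-side K * sigma m end up inside it. *)
  have [m0 y_away] := A0_away y Yy.
  have [j yj] : exists j, A m0 j y.
    have : (Y `\` A0 m0) y.
      split => // A0y; have : (cube y (delta m0) `&` A0 m0) y.
        by split => // i; rewrite subrr normr0 divr_ge0// ltW.
      by rewrite y_away.
    by rewrite -(grid_cellsE (A_partition m0)) => -[j _ yj]; exists j.
  have [AE _ _ _ _] := A_partition m0; rewrite AE in yj.
  have near_small (u : nat -> R) a : (forall m, 0 <= u m) ->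
      u m @[m --> \oo] --> 0 -> 0 < a -> \forall m \near \oo, K * u m < a.
    move=> u0 ucv a0; near=> m; apply: (@le_lt_trans _ _ ((K + 1) * u m)).
      by rewrite ler_wpM2r// lerDl.
    rewrite -ltr_pdivlMl//; near: m; apply: (cvgr_lt _ ucv).
    by rewrite mulr_gt0 ?invr_gt0.
  have sigma_ge0 m : 0 <= sigma m by exact: ltW.
  have near_lo : \forall m \near \oo, forall i,
      K * sigma m < y ord0 i - (mu m0 j ord0 i - h m0 / 2).
    apply: filter_forall => i; apply: near_small => //.
    have /andP[y1 _] := yj i; rewrite subr_gt0 lt_neqAle y1 andbT eq_sym.
    by apply/eqP; exact: off.
  have near_hi : \forall m \near \oo, forall i,
      K * sigma m < mu m0 j ord0 i + h m0 / 2 - y ord0 i.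
    apply: filter_forall => i; apply: near_small => //.
    by have /andP[_ y1] := yj i; rewrite subr_gt0.
  near=> m.
  have sig_lo i : K * sigma m < y ord0 i - (mu m0 j ord0 i - h m0 / 2).
    by move: i; near: m; exact: near_lo.
  have sig_hi i : K * sigma m < mu m0 j ord0 i + h m0 / 2 - y ord0 i.
    by move: i; near: m; exact: near_hi.
  have sig_eps : K * sigma m < eps by near: m; exact: near_small.
  have sig_delta : K * sigma m <= delta m / 2.
    have : K * (sigma m / delta m) < 2^-1.
      near: m; apply: near_small => // m; exact: divr_ge0 (ltW (delta_gt0 m)).
    by rewrite mulrA ltr_pdivrMr// => /ltW; rewrite [2^-1 * _]mulrC.
  have s_eps : 2 * s m < eps ^+ 2.
    rewrite -ltr_pdivlMl//; near: m; apply: (cvgr_lt _ s_cvg).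
    by rewrite mulr_gt0 ?exprn_gt0.
  have WE : expR (- (e / 4)) <= W m.
    by near: m; apply: (cvgr_ge _ W_cvg); rewrite -subr_gt0.
  have ME : expR (- (e / 4)) <= expR (- (d%:R *
      (K * (h m / sigma m) / 2 + (h m / sigma m) ^+ 2 / 8))).
    near: m; apply: near_shift_exponent_le => // m.
    by rewrite divr_ge0// ltW.
  have m0m : (m0 <= m)%N by near: m; exact: nbhs_infty_ge.
  have cube_sub : cube y (2 * (K * sigma m)) `<=` Y `\` A0 m.
    move=> v yv; have {}yv i : `|v ord0 i - y ord0 i| <= K * sigma m.
      by have := yv i; rewrite (_ : 2 * (K * sigma m) / 2 = K * sigma m)//; field.
    split.
      apply: (grid_cell_sub (A_partition m0)); rewrite AE => i.
      have := yv i; have := sig_lo i; have := sig_hi i.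
      by rewrite ler_norml => ? ? /andP[? ?]; apply/andP; split; lra.
    move=> A0v; have : (cube y (delta m) `&` A0 m) v.
      by split => // i; exact: le_trans (yv i) sig_delta.
    by rewrite y_away.
  have l0 : 0 <= l by rewrite mulr_ge0 ?expR_ge0 ?ltW.
  have := model3_ge_cube mY mX f0 mf intf (A_partition m) (sigma_gt0 m) sigma0_gt0
    (Xxc m) (ltW (h_gt0 m)) K_ge0 (expR_ge0 _) l0 _
    (le_trans WE (W_le m x Xx)) cube_sub.
  have c1 : 2 `^ (d%:R / 2) * expR (- (K ^+ 2 / 4)) <= 1 :> R.
    by rewrite -subr_ge0; exact: le_trans EK; exact: expR_ge0.
  move=> /(_ c1); rewrite -/(p m); move=> ple; apply: le_trans (ple _); last first.
    move=> i z xi cz; apply: ltW; apply: (fbox (z, xc m i)) => /=.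
    - by split => /=; [case: (cube_sub z cz)|exact: Xxc].
    - move=> k; apply: le_lt_trans sig_eps; have := cz k.
      by rewrite (_ : 2 * (K * sigma m) / 2 = K * sigma m)//; field.
    - move=> k; rewrite -ltr_sqr ?nnegrE// ?(ltW eps0)// real_normK ?num_real//.
      apply: le_lt_trans s_eps; apply: le_trans xi.
      exact: sqr_coord_le_sqdist.
  (* The four factors exp (- e / 4) pay for the weights of the far cells, the
     variation of f, the displacement of the centers and the Gaussian tail. *)
  rewrite (_ : f y x * expR (- e) =
    expR (- (e / 4)) * (l * (expR (- (e / 4)) * expR (- (e / 4))))); last first.
    rewrite /l (_ : - e = - (e / 4) + - (e / 4) + (- (e / 4) + - (e / 4))).
      by rewrite !expRD; ring.
    by field.
  rewrite ler_wpM2l ?expR_ge0// ler_wpM2l//.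
  by rewrite ler_pM ?expR_ge0.
- move=> m; have f0D z : (Y `*` X) z -> 0 <= f z.1 z.2.
    by move=> [/= Yz Xz]; exact: f0.
  exact: (integral_neg_log_ratio mYX mf (mp m) f0D (fun z _ => p_gt0 m _ _)
    FYX Fk (intp m)).
(* The envelope is negative only where f vanishes, by the convention
   lne (0 / 0) = -oo, and F does not charge that set. *)
- pose Z := [set z : 'rV[R]_d * 'rV[R]_dx | f z.1 z.2 <= 0].
  have mZ : measurable (Y `*` X `&` Z).
    have mle : measurable_fun (Y `*` X) (fun z => f z.1 z.2 <= 0).
      exact: measurable_fun_ler.
    exact: (mle mYX [set true]).
  have FZ : F (Y `*` X `&` Z) = 0%E.
    rewrite Fk//; apply: integral0_eq => z [[/= Yz Xz] Zz].
    rewrite patchE mem_set//; congr EFin; apply/eqP.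
    by rewrite eq_le Zz f0.
  transitivity (\int[F]_(z in Y `*` X) ((cst +oo%E) \_ Z) z)%E.
    apply: eq_integral => -[y x] /set_mem[/= Yy Xx]; rewrite patchE funenegE.
    have [fyx|fyx] := leP (f y x) 0.
      rewrite mem_set// (_ : f y x = 0) ?mul0e ?le0_lneNy ?max_l ?leey//=.
      by apply/eqP; rewrite eq_le fyx f0.
    rewrite memNset ?max_r// ?oppe_le0 ?lne_ge0.
      by apply: ratio_ge1; [|exact: local_inf_ge0|exact: local_inf_le].
    by apply/negP; rewrite -ltNge.
  by rewrite -integral_mkcondr; apply: null_set_integral.
- apply: (eq_integrable mYX (fun z => K0%:E +
      \sum_(i < d) (2 * sigma0 ^+ 2)^-1%:E * (z.1 ord0 i * z.1 ord0 i)%:E)%E).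
    move=> z _; rewrite sumEFin -EFinD /H /=; congr (_ + _)%:E.
    rewrite /sqdist mulr_suml; apply: eq_bigr => i _.
    by rewrite !mxE subr0 mulrC expr2.
  apply: integrableD => //; first exact: finite_measure_integrable_cst.
  by apply: integrable_sum => // i _; apply: integrableZl.
- near=> m.
  have hs : h m <= sigma m.
    rewrite -[leRHS]mul1r -ler_pdivrMr//; near: m.
    exact: (cvgr_le _ h_sigma _ ltr01).
  have sr : sigma m <= r / 2.
    by near: m; apply: (cvgr_le _ sigma_cvg); rewrite divr_gt0.
  have s2 : 2 * s m <= r ^+ 2.
    rewrite -ler_pdivlMl//; near: m; apply: (cvgr_le _ s_cvg).
    by rewrite mulr_gt0 ?exprn_gt0.
  have W2 : 2^-1 <= W m by near: m; apply: (cvgr_ge _ W_cvg); lra.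
  have Mm : (M <= m)%N by near: m; exact: nbhs_infty_ge.
  move=> [y x] [/= Yy Xx].
  rewrite !funeposE; apply: pos_log_ratio_envelope => //.
  + exact: f0.
  + exact: p_gt0.
  + by rewrite addr_ge0// divr_ge0 ?sqdist_ge0// mulr_ge0 ?sqr_ge0.
  + exact: local_inf_ge0.
  + exact: local_inf_le.
  + move=> l l0 lf.
    apply: (model3_ge_local_inf mY mX f0 mf intf (A_partition m)
      (sigma_gt0 m) sigma0_gt0 (Xxc m) (s := s m) (r := r) (C := C y x)) => //.
    * by rewrite hs ltW.
    * exact: le_trans W2 (W_le m x Xx).
    * by move=> A0y; exists (C0 m y x); exact: C0_spec.
    * exact: C1_spec.
Unshelve. all: by end_near. Qed.
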